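(* Let $\eta\in[0,1]$, let $2\le n\le9$, and let $\bar\psi$ be the $\mathcal{H}^1$-elliptic envelope of $\psi(b,t)=|b|^2+\eta(b\cdot t)^2$, $\psi:\mathbb{Z}^n\times\mathcal{S}^{n-1}\to\mathbb{R}$. Then for all $i\in\{1,\dots,n\}$, $\beta\in\mathbb{Z}$ and $t\in\mathcal{S}^{n-1}$ we have $$\bar\psi(\beta e_i,t)=|\beta|\,\psi(e_i,t).$$
   Context: $e_1,\dots,e_n$ is the canonical basis of $\mathbb{R}^n$. For $\Omega\subset\mathbb{R}^n$ open, $\mathcal{M}_{\rm df}^{(n)}(\Omega)$ is the set of finite $\mathbb{R}^{n\times n}$-valued Radon measures on $\Omega$ of the form $\mu=\theta\otimes\tau\,\mathcal{H}^1\llcorner\gamma$, where $\gamma\subset\Omega$ is $1$-rectifiable, $\tau:\gamma\to\mathcal{S}^{n-1}$ is its unit tangent vector, $\theta:\gamma\to\mathbb{Z}^n$ is $\mathcal{H}^1$-integrable, and $\mu$ is divergence-free, i.e. $\sum_{j=1}^n\int_\Omega\partial_j\varphi\,d\mu_{ij}=0$ for all $\varphi\in C_c^\infty(\Omega)$ and $i=1,\dots,n$. The $\mathcal{H}^1$-elliptic envelope of $\psi$ is, for $b\in\mathbb{Z}^n$, $t\in\mathcal{S}^{n-1}$, $$\bar\psi(b,t)=\inf\Big\{\int_\gamma\psi(\theta,\tau)\,d\mathcal{H}^1:\ \mu=\theta\otimes\tau\,\mathcal{H}^1\llcorner\gamma\in\mathcal{M}_{\rm df}^{(n)}(B_{1/2}),\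 \mathrm{supp}\big(\mu-b\otimes t\,\mathcal{H}^1\llcorner(\mathbb{R}t\cap B_{1/2})\big)\subset B_{1/2}\Big\},$$ where $B_{1/2}\subset\mathbb{R}^n$ is the ball of radius $1/2$ centered at $0$; the support condition means that there is a ball $B'\subset\subset B_{1/2}$ with $\mu=b\otimes t\,\mathcal{H}^1\llcorner\mathbb{R}t$ on $B_{1/2}\setminus B'$. *)

(* Defs.v *)
From HB Require Import structures.
From mathcomp Require Import all_boot all_order all_algebra.
From mathcomp Require Import all_classical all_reals all_analysis.

Set Implicit Arguments.
Unset Strict Implicit.
Unset Printing Implicit Defensive.
Import Order.TTheory GRing.Theory Num.Theory.
Import numFieldNormedType.Exports.

Local Open Scope classical_set_scope.
Local Open Scope ring_scope.

(* The norm that the library puts on 'rV[R]_n is the sup norm. It induces the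
   right topology, but lengths, balls and diameters here are Euclidean. *)
Section euclidean.
Context {R : realType} {n : nat}.
Implicit Types x y v : 'rV[R]_n.

Definition dot x y : R := \sum_(k < n) x 0 k * y 0 k.

Definition enorm x : R := Num.sqrt (dot x x).

Definition eball x (r : R) : set 'rV[R]_n := [set y | enorm (y - x) < r].

(* Adding 0 gives the empty set diameter 0 instead of -oo. *)
Definition ediam (A : set 'rV[R]_n) : \bar R :=
  ereal_sup (0%E |` [set (enorm (p.1 - p.2))%:E | p in A `*` A]).

Lemma ediam_ge0 A : (0 <= ediam A)%E.
Proof. by apply: ereal_sup_ubound; left. Qed.

Lemma ediam0 : ediam set0 = 0%E.
Proof.
apply/eqP; rewrite eq_le ediam_ge0 andbT; apply: ge_ereal_sup => x [->//|].
by move=> [[a b] []].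
Qed.

Definition line v : set 'rV[R]_n := [set s *: v | s in [set: R]].

End euclidean.

Section hausdorff1.
Context {R : realType} {n : nat}.
Local Notation V := 'rV[R]_n.
Local Open Scope ereal_scope.

Definition fine_cover (delta : R) (A : set V) : set (set V)^nat :=
  [set F | A `<=` \bigcup_k F k /\ forall k, ediam (F k) <= delta%:E].

Definition hausdorff1_delta (delta : R) (A : set V) : \bar R :=
  ereal_inf [set \sum_(k <oo) ediam (F k) | F in fine_cover delta A].

(* The normalising constant is 1: in dimension one the volume of the unit ball
   times (diam / 2) is diam. *)
Definition hausdorff1 (A : set V) : \bar R :=
  ereal_sup [set hausdorff1_delta delta A | delta in [set d : R | (0 < d)%R]].

Lemma hausdorff1_delta_ge0 delta A : 0 <= hausdorff1_delta delta A.
Proof.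
apply: le_ereal_inf_tmp => _ [F _ <-].
by apply: nneseries_ge0 => k _ _; exact: ediam_ge0.
Qed.

Lemma hausdorff1_delta_le_hausdorff1 delta A : (0 < delta)%R ->
  hausdorff1_delta delta A <= hausdorff1 A.
Proof. by move=> d0; apply: ereal_sup_ubound; exists delta. Qed.

Lemma hausdorff1_delta_sigma_subadditive delta :
  sigma_subadditive (hausdorff1_delta delta).
Proof.
move=> A; have [[i ioo]|] := pselect (exists i, hausdorff1_delta delta (A i) = +oo).
  rewrite (eseries_pinfty _ _ ioo) ?leey// => k _.
  by rewrite -ltNye (lt_le_trans _ (hausdorff1_delta_ge0 _ _)).
rewrite -forallNE => Aoo.
suff add2e (e : {posnum R}) : hausdorff1_delta delta (\bigcup_k A k) <=
    \sum_(i <oo) hausdorff1_delta delta (A i) + e%:num%:E.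
  by apply/lee_addgt0Pr => _/posnumP[].
rewrite (le_trans _ (epsilon_trick _ _ _))//; last first.
  by move=> k; exact: hausdorff1_delta_ge0.
pose P k (B : (set V)^nat) := fine_cover delta (A k) B /\
  \sum_(j <oo) ediam (B j) <=
  hausdorff1_delta delta (A k) + (e%:num / (2 ^ k.+1)%:R)%:E.
have [G PG] : {G : ((set V)^nat)^nat & forall k, P k (G k)}.
  apply: (@choice _ _ P) => k; rewrite /P /hausdorff1_delta.
  set S := (X in ereal_inf X); move infS : (ereal_inf S) => iS.
  case: iS infS => [r Sr|Soo|Soo].
  - have en1 : (0 < e%:num / (2 ^ k.+1)%:R)%R by [].
    have /(lb_ereal_inf_adherent en1) : ereal_inf S \is a fin_num by rewrite Sr.
    move=> [x [B AB <-{x}] xS].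
    by exists B; split => //; rewrite -Sr; exact/ltW.
  - by have := Aoo k; rewrite /hausdorff1_delta Soo.
  - by have := hausdorff1_delta_ge0 delta (A k); rewrite /hausdorff1_delta Soo.
have muG_ge0 x : 0 <= (ediam \o uncurry G) x by exact: ediam_ge0.
apply: (@le_trans _ _ (\esum_(i in setT) (ediam \o uncurry G) i)).
  apply: ereal_inf_lbound => /=.
  have /card_esym/ppcard_eqP[f] := card_nat2.
  exists (uncurry G \o f).
    split => [|i]; last first.
      by rewrite /=; case: (f i) => a b; have [[_ Gd] _] := PG a; exact: Gd.
    apply: (@subset_trans _ (\bigcup_k \bigcup_j G k j)) => [t [i _]|].
      have [[AG _] _] := PG i.
      by move=> /AG -[j _ ?]; exists i => //; exists j.
    move=> t [i _ [j _ Bijt]]; exists (f^-1%FUN (i, j)) => //=.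
    by rewrite invK ?inE.
  rewrite -(esum_pred_image (ediam \o uncurry G) _ xpredT) ?[fun=> _]set_true//.
  by rewrite image_eq.
rewrite (_ : esum _ _ = \sum_(i <oo) \sum_(j <oo) ediam (G i j)); last first.
  pose J : nat -> set (nat * nat) := fun i => [set (i, j) | j in setT].
  rewrite (_ : setT = \bigcup_k J k); last first.
    by rewrite predeqE => -[a b]; split => // _; exists a => //; exists b.
  rewrite esum_bigcupT /=; last 2 first.
    - apply/trivIsetP => i j _ _ ij.
      rewrite predeqE => -[k m] /=; split => //= -[] [_] _ [<-{k} _].
      by move=> [m' _] [] /esym/eqP; rewrite (negbTE ij).
    - by move=> x; exact: muG_ge0.
  rewrite -(image_id [set: nat]) -fun_true esum_pred_image//; last first.
    by move=> k _; apply: esum_ge0 => x _; exact: muG_ge0.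
  apply: eq_eseriesr => /= j _.
  rewrite -(esum_pred_image (ediam \o uncurry G) (pair j) predT)//=.
  - by congr esum; rewrite predeqE => -[a b]; split; move=> [i _ <-]; exists i.
  - by move=> k _; exact: (muG_ge0 (j, k)).
  - by move=> ? ? _ _; exact: (@can_inj _ _ _ snd).
apply: lee_nneseries => i _; last exact: (PG i).2.
by move=> _; apply: nneseries_ge0 => m _ _; exact: (muG_ge0 (i, m)).
Qed.

Lemma hausdorff1_ge0 A : 0 <= hausdorff1 A.
Proof.
apply: le_trans (hausdorff1_delta_le_hausdorff1 A ltr01).
exact: hausdorff1_delta_ge0.
Qed.

Lemma hausdorff10 : hausdorff1 set0 = 0.
Proof.
apply/eqP; rewrite eq_le hausdorff1_ge0 andbT.
apply: ge_ereal_sup => _ [d d0 <-]; apply: ereal_inf_lbound.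
exists (fun=> set0); first by split => // k; rewrite ediam0 lee_fin ltW.
by apply: eseries0 => k _ _; exact: ediam0.
Qed.

Lemma le_hausdorff1 : {homo hausdorff1 : A B / A `<=` B >-> A <= B}.
Proof.
move=> A B AB; apply: ge_ereal_sup => _ [d d0 <-].
apply: le_trans (hausdorff1_delta_le_hausdorff1 _ d0).
apply: ereal_inf_le_tmp => _ [F [BF Fd] <-].
by exists F => //; split => //; exact: subset_trans BF.
Qed.

Lemma hausdorff1_sigma_subadditive : sigma_subadditive hausdorff1.
Proof.
move=> F; apply: ge_ereal_sup => _ [d d0 <-].
apply: (le_trans (hausdorff1_delta_sigma_subadditive d F)).
apply: lee_nneseries => k _; last exact: hausdorff1_delta_le_hausdorff1.
by move=> _; exact: hausdorff1_delta_ge0.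
Qed.

HB.instance Definition _ := isOuterMeasure.Build R V hausdorff1
  hausdorff10 hausdorff1_ge0 le_hausdorff1 hausdorff1_sigma_subadditive.

End hausdorff1.

(* R^n with the sigma-algebra of hausdorff1-measurable (Caratheodory) sets;
   measurability, integrals and "almost everywhere" below all refer to it. *)
Notation H1space R n := (caratheodory_type (@hausdorff1 R n)).

Definition H1 (R : realType) (n : nat) : {measure set (H1space R n) -> \bar R} :=
  let mu : {outer_measure set 'rV[R]_n -> \bar R} := @hausdorff1 R n in
  (mu : set (caratheodory_type mu) -> \bar R).

Section rectifiable_measures.
Context {R : realType} {n : nat}.
Local Notation V := 'rV[R]_n.

Definition rectifiable1 (gamma : set V) : Prop :=
  [/\ measurable (gamma : set (H1space R n)),
      (hausdorff1 gamma < +oo)%E &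
      exists f : nat -> R -> V, (forall k, lipschitz (f k)) /\
        hausdorff1 (gamma `\` \bigcup_k range (f k)) = 0%E].

(* The complement of the open cone with vertex x around the line spanned by the
   unit vector v: z - dot z v *: v is the component of z orthogonal to v. *)
Definition off_cone (x v : V) (s : R) : set V :=
  [set y | s * enorm (y - x) <= enorm ((y - x) - dot (y - x) v *: v)].

(* line v is the approximate tangent line of gamma at x: gamma has positive
   upper density at x, and density 0 outside every cone around x + line v. *)
Definition approx_tangent (gamma : set V) (x v : V) : Prop :=
  [/\ enorm v = 1,
      (0 < limf_esup (fun r : R =>
             (r^-1)%:E * hausdorff1 (gamma `&` eball x r)) 0^'+)%E &
      forall s : R, 0 < s ->
        ((r^-1)%:E * hausdorff1 (gamma `&` eball x r `&` off_cone x v s))%E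
          @[r --> 0^'+] --> 0%E].

Definition unit_tangent (gamma : set V) (tau : V -> V) : Prop :=
  [/\ forall x, gamma x -> enorm (tau x) = 1,
      forall j, measurable_fun (gamma : set (H1space R n))
                  (fun x : H1space R n => tau x 0 j) &
      {ae H1 R n, forall x, gamma x -> approx_tangent gamma x (tau x)}].

Definition integrable_multiplicity (gamma : set V)
    (theta : V -> 'rV[int]_n) : Prop :=
  forall i, (H1 R n).-integrable gamma (fun x => ((theta x 0 i)%:~R : R)%:E).

(* The triple (gamma, theta, tau) stands for the matrix-valued measure
   mu = theta (x) tau H^1 |_ gamma. As mu_ij has density theta_i tau_j with
   respect to H^1 |_ gamma, integral_wrt is the integral of f against mu_ij. *)
Definition integral_wrt (gamma : set V) (theta : V -> 'rV[int]_n)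
    (tau : V -> V) (i j : 'I_n) (f : V -> R) : R :=
  \int[H1 R n]_(x in gamma) (f x * ((theta x 0 i)%:~R * tau x 0 j)).

Definition rect_measure (gamma : set V) (theta : V -> 'rV[int]_n)
    (tau : V -> V) (E : set V) : 'M[R]_n :=
  \matrix_(i, j) integral_wrt gamma theta tau i j (\1_E).

Definition partial (j : 'I_n) (f : V -> R) : V -> R :=
  fun x => 'D_(delta_mx 0 j) f x.

Definition smooth (f : V -> R) : Prop :=
  forall s : seq 'I_n, let g := foldr partial f s in
    continuous g /\ forall j x, derivable g x (delta_mx 0 j).

Definition test_function (Omega : set V) (phi : V -> R) : Prop :=
  let supp := closure [set x | phi x != 0] in
  [/\ smooth phi, compact supp & supp `<=` Omega].

Definition divergence_free (Omega : set V) (gamma : set V)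
    (theta : V -> 'rV[int]_n) (tau : V -> V) : Prop :=
  forall phi, test_function Omega phi -> forall i : 'I_n,
    \sum_(j < n) integral_wrt gamma theta tau i j (partial j phi) = 0.

Definition Mdf (Omega : set V) (gamma : set V)
    (theta : V -> 'rV[int]_n) (tau : V -> V) : Prop :=
  [/\ gamma `<=` Omega, rectifiable1 gamma, unit_tangent gamma tau,
      integrable_multiplicity gamma theta &
      divergence_free Omega gamma theta tau].

Definition borel : set (set V) := <<s [set U : set V | open U] >>.

Definition Bhalf : set V := eball 0 (2^-1).

(* Outside some ball B' compactly contained in Bhalf, the measure
   agrees with b (x) t H^1 |_ line t. *)
Definition straight_near_boundary (gamma : set V) (theta : V -> 'rV[int]_n)
    (tau : V -> V) (b : 'rV[int]_n) (t : V) : Prop :=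
  exists (c : V) (r : R), [/\ 0 < r, compact (closure (eball c r)),
    closure (eball c r) `<=` Bhalf &
    forall E, borel E -> E `<=` Bhalf `\` eball c r ->
      rect_measure gamma theta tau E =
      rect_measure (line t `&` Bhalf) (fun=> b) (fun=> t) E].

Definition H1_elliptic_envelope (psi : 'rV[int]_n -> V -> R)
    (b : 'rV[int]_n) (t : V) : \bar R :=
  ereal_inf [set e | exists gamma theta tau,
    [/\ Mdf Bhalf gamma theta tau,
        straight_near_boundary gamma theta tau b t &
        e = (\int[H1 R n]_(x in gamma) (psi (theta x) (tau x))%:E)%E]].

Definition int_vec (b : 'rV[int]_n) : V := map_mx intr b.

Definition psi (eta : R) (b : 'rV[int]_n) (t : V) : R :=
  enorm (int_vec b) ^+ 2 + eta * dot (int_vec b) t ^+ 2.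

End rectifiable_measures.

(* Main.v *)
(* Lower bound. For unit w one has psi b w >= |b_i| (1 + eta w_i^2): if b is a
   multiple of e_i this is b_i^2 >= |b_i|, otherwise |b|^2 >= b_i^2 + 1 >=
   2 |b_i|. The right-hand side is f (b_i w) for the even 1-homogeneous function
   f v = |v| + eta v_i^2 / |v|, which for eta <= 1 lies above its linearization
   l at t; hence psi theta tau >= sgn(beta) theta_i (l . tau). The integral of
   this minorant depends only on the boundary data, since the divergence
   constraint forces the total mass of theta_i tau to be beta t, and it equals
   |beta| f t.

   Upper bound. Just inside the boundary, split the line of multiplicity
   beta e_i into |beta| nearly straight paths of multiplicity sgn(beta) e_i at
   distinct heights in a direction orthogonal to t, and rejoin them at the other
   end; as the heights and the two outer pieces shrink, the energy tends to
   |beta| psi e_i t.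

   Both parts integrate along segments: hausdorff1 is a metric outer measure, so
   Borel sets are measurable, and on a line it coincides with Lebesgue measure. *)
Require Import Defs.
From HB Require Import structures.
From mathcomp Require Import all_boot all_order all_algebra.
From mathcomp Require Import all_classical all_reals all_analysis.
From mathcomp Require Import measurable_realfun.
From mathcomp Require Import ring lra.
Set Implicit Arguments.
Unset Strict Implicit.
Unset Printing Implicit Defensive.
Import Order.TTheory GRing.Theory Num.Theory.
Import numFieldNormedType.Exports.

Local Open Scope classical_set_scope.
Local Open Scope ring_scope.

(** The straight line of multiplicity [beta *: delta_mx 0 i] is itself a competitor, but [psi] is
    quadratic in the multiplicity and charges it [beta ^+ 2] instead of [|beta|]. Stacking unit
    paths on one line does not help: the multiplicity is a function on the carrier, so coinciding
    lines merge into one of multiplicity [beta]. Hence the paths are kept disjoint away from their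
    ends, at an extra cost proportional to the length of the outer pieces. For the lower bound a
    competitor is an arbitrary rectifiable measure, with no decomposition into paths at hand. What
    makes the minorant computable is that the calibrating vector is constant: it is the gradient of
    a linear function, hence invisible to a divergence-free measure up to boundary effects. Two gaps
    remain. A linear function has no compact support, so a smooth cutoff is built from exp(-1/s);
    and the boundary condition compares the measures on Borel sets while the test involves
    functions, so equality on superlevel sets of a bounded function has to be turned into equality
    of integrals. *)

(** * Euclidean inner product, norm and balls *)

Section euclidean_norm.
Context {R : realType} {n : nat}.
Local Notation V := 'rV[R]_n.
Implicit Types (x y z v : V) (a : R).

Lemma dotC x y : dot x y = dot y x.
Proof. by apply: eq_bigr => k _; rewrite mulrC. Qed.

Lemma dotDl x y z : dot (x + y) z = dot x z + dot y z.
Proof. by rewrite -big_split; apply: eq_bigr => k _; rewrite mxE mulrDl. Qed.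

Lemma dotZl a x y : dot (a *: x) y = a * dot x y.
Proof. by rewrite mulr_sumr; apply: eq_bigr => k _; rewrite mxE mulrA. Qed.

Lemma dotNl x y : dot (- x) y = - dot x y.
Proof. by rewrite -scaleN1r dotZl mulN1r. Qed.

Lemma dotBl x y z : dot (x - y) z = dot x z - dot y z.
Proof. by rewrite dotDl dotNl. Qed.

Lemma dotDr x y z : dot z (x + y) = dot z x + dot z y.
Proof. by rewrite dotC dotDl !(dotC z). Qed.

Lemma dotZr a x y : dot y (a *: x) = a * dot y x.
Proof. by rewrite dotC dotZl (dotC y). Qed.

Lemma dotBr x y z : dot z (x - y) = dot z x - dot z y.
Proof. by rewrite dotC dotBl !(dotC z). Qed.

Lemma dot0l y : dot 0 y = 0.
Proof. by rewrite -(scale0r 0) dotZl mul0r. Qed.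

Lemma dot_delta x (k : 'I_n) : dot x (delta_mx 0 k) = x 0 k.
Proof.
rewrite /dot (bigD1 k)//= mxE !eqxx mulr1 big1 ?addr0// => j /negPf jk.
by rewrite mxE jk andbF mulr0.
Qed.

Lemma dot_ge0 x : 0 <= dot x x.
Proof. by apply: sumr_ge0 => k _; rewrite -expr2 sqr_ge0. Qed.

Lemma enorm_ge0 x : 0 <= enorm x. Proof. exact: sqrtr_ge0. Qed.

Lemma sqr_enorm x : enorm x ^+ 2 = dot x x.
Proof. by rewrite sqr_sqrtr// dot_ge0. Qed.

Lemma dot_unit v : enorm v = 1 -> dot v v = 1.
Proof. by rewrite -sqr_enorm => ->; rewrite expr1n. Qed.

Lemma enormZ a x : enorm (a *: x) = `|a| * enorm x.
Proof. by rewrite /enorm dotZl dotZr mulrA -expr2 sqrtrM ?sqr_ge0// sqrtr_sqr. Qed.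

Lemma enormN x : enorm (- x) = enorm x.
Proof. by rewrite -scaleN1r enormZ normrN1 mul1r. Qed.

Lemma enorm0 : enorm (0 : 'rV[R]_n) = 0.
Proof. by rewrite -(scale0r 0) enormZ normr0 mul0r. Qed.

Lemma enorm_distC x y : enorm (x - y) = enorm (y - x).
Proof. by rewrite -enormN opprB. Qed.

Lemma sqr_coord_le_dot x k : x 0 k ^+ 2 <= dot x x.
Proof.
rewrite /dot (bigD1 k)//= expr2 lerDl.
by apply: sumr_ge0 => j _; rewrite -expr2 sqr_ge0.
Qed.

Lemma coord_le_enorm x k : `|x 0 k| <= enorm x.
Proof. by rewrite -sqrtr_sqr ler_wsqrtr// sqr_coord_le_dot. Qed.

Lemma enorm_eq0 x : enorm x = 0 -> x = 0.
Proof.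
move=> x0; apply/rowP => k; rewrite mxE; apply/eqP.
by rewrite -normr_le0 -x0 coord_le_enorm.
Qed.

Lemma sqr_dot_le x y : dot x y ^+ 2 <= dot x x * dot y y.
Proof.
have [/eqP|y0] := eqVneq (enorm y) 0.
  by move=> /eqP/enorm_eq0 ->; rewrite dotC !dot0l mulr0 expr0n.
have yy : 0 < dot y y by rewrite -sqr_enorm exprn_gt0// lt_def y0 enorm_ge0.
(* Cauchy-Schwarz: this vector is [dot y y] times the component of [x] orthogonal to [y]. *)
have := dot_ge0 (dot y y *: x - dot x y *: y).
rewrite !(dotBl, dotBr, dotZl, dotZr) (dotC y x) => h.
have {}h : 0 <= dot y y * (dot x x * dot y y - dot x y ^+ 2).
  by apply: le_trans h _; rewrite le_eqVlt; apply/orP; left; apply/eqP; ring.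
by rewrite -subr_ge0 -(pmulr_rge0 _ yy).
Qed.

Lemma dot_le_enormM x y : `|dot x y| <= enorm x * enorm y.
Proof.
rewrite -[leLHS]sqrtr_sqr /enorm -sqrtrM ?dot_ge0//.
by rewrite ler_wsqrtr// sqr_dot_le.
Qed.

Lemma ler_enormD x y : enorm (x + y) <= enorm x + enorm y.
Proof.
rewrite -(ler_pXn2r (ltn0Sn 1)) ?nnegrE ?addr_ge0 ?enorm_ge0//.
rewrite sqr_enorm dotDl !dotDr -!sqr_enorm (dotC y x).
have := le_trans (ler_norm _) (dot_le_enormM x y).
by move=> h; nra.
Qed.

(** The bridge to the ambient topology, which comes from the sup norm: Euclidean balls are bounded,
    and every neighbourhood contains one. *)
Lemma norm_le_enorm x : `|x| <= enorm x.
Proof.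
rewrite [leLHS]/Num.norm /= mx_normrE; apply/bigmax_leP; split => [|[i j] _].
  exact: enorm_ge0.
by rewrite /= ord1 coord_le_enorm.
Qed.

Lemma coord_le_norm x k : `|x 0 k| <= `|x|.
Proof.
rewrite [leRHS]/Num.norm /= mx_normrE.
exact: (le_bigmax _ (fun ij : 'I_1 * 'I_n => `|x ij.1 ij.2|) (0, k)).
Qed.

Lemma enorm_delta (k : 'I_n) : enorm (delta_mx 0 k : 'rV[R]_n) = 1.
Proof. by rewrite /enorm dot_delta mxE !eqxx sqrtr1. Qed.

Lemma dot_continuous v : continuous (fun x => dot x v).
Proof.
apply: continuous_big => //; first exact: add_continuous.
move=> k _ x; apply: (@continuousM R V (fun x : V => x 0 k)).
  exact: coord_continuous.
exact: cst_continuous.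
Qed.

Lemma dotxx_continuous : continuous (fun x => dot x x).
Proof.
apply: continuous_big => //; first exact: add_continuous.
move=> k _ x; apply: (@continuousM R V (fun x : V => x 0 k)); exact: coord_continuous.
Qed.

Lemma enorm_continuous : continuous (@enorm R n).
Proof.
move=> x; apply: (@continuous_comp _ _ _ (fun x => dot x x) Num.sqrt).
  exact: dotxx_continuous.
exact: sqrt_continuous.
Qed.

Lemma enormB_continuous v : continuous (fun x => enorm (x - v)).
Proof.
move=> x; apply: (@continuous_comp _ _ _ (fun x => x - v) (@enorm R n)).
  by apply: (@cvgB _ _ _ (nbhs x)); [exact: cvg_id|exact: cvg_cst].
exact: enorm_continuous.
Qed.

Lemma eball_open v r : open (eball v r).
Proof.
rewrite (_ : eball v r = (fun x => enorm (x - v)) @^-1` [set s | s < r])//.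
by have /continuousP := @enormB_continuous v; apply; exact: open_lt.
Qed.

Lemma closed_eball v r : closed [set x | enorm (x - v) <= r].
Proof.
rewrite (_ : mkset _ = (fun x => enorm (x - v)) @^-1` [set s | s <= r])//.
by have /continuous_closedP := @enormB_continuous v; apply; exact: closed_le.
Qed.

Lemma compact_eball v r : compact [set x | enorm (x - v) <= r].
Proof.
apply: bounded_closed_compact; last exact: closed_eball.
exists (r + enorm v); split; first exact: num_real.
move=> M rM x /= xr; rewrite (le_trans (norm_le_enorm x))//.
rewrite -(subrK v x) (le_trans (ler_enormD _ _))//.
by rewrite (le_trans _ (ltW rM))// lerD2r.
Qed.

Lemma nbhs_eball (x : 'rV[R]_n) (A : set 'rV[R]_n) : nbhs x A ->
  exists2 e, 0 < e & eball x e `<=` A.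
Proof.
move=> /nbhs_normP[e /= e0 eA]; exists e => // y xy; apply: eA => /=.
by rewrite -[_ (x - y)]normrN opprB (le_lt_trans (norm_le_enorm _)).
Qed.

End euclidean_norm.

(** * The Hausdorff measure is a metric outer measure *)

Section metric_outer_measure.
Context {R : realType} {n : nat}.
Local Notation V := 'rV[R]_n.
Local Notation mu := (@hausdorff1 R n).
Local Open Scope ereal_scope.
Implicit Types (A B X : set V) (x y : V) (d : R).

Lemma le_ediam A x y : A x -> A y -> (enorm (x - y))%:E <= ediam A.
Proof. by move=> Ax Ay; apply: ereal_sup_ubound; right; exists (x, y). Qed.

Lemma ediam_le A d : (0 <= d)%R ->
  (forall x y, A x -> A y -> (enorm (x - y) <= d)%R) -> ediam A <= d%:E.
Proof.
move=> d0 Ad; apply: ge_ereal_sup => _ [->|[[x y] [Ax Ay] <-]].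
  by rewrite lee_fin.
by rewrite lee_fin Ad.
Qed.

(** A covering set of diameter less than [d] cannot meet both [A] and [B], so a fine cover of the
    union splits into a cover of each; pieces missing a set are replaced by the empty set, of
    diameter 0. The two meshes are independent so that the suprema over them can be taken one after
    the other. *)
Lemma hausdorff1_delta_separated A B (d1 d2 d : R) :
  (0 < d)%R -> (0 < d1)%R -> (0 < d2)%R ->
  (forall x y, A x -> B y -> (d <= enorm (x - y))%R) ->
  hausdorff1_delta d1 A + hausdorff1_delta d2 B <= mu (A `|` B).
Proof.
move=> d0 d10 d20 ABd.
pose e : R := Num.min (Num.min d1 d2) (d / 2)%R.
have e0 : (0 < e)%R by rewrite !lt_min d10 d20 divr_gt0.
apply: le_trans (hausdorff1_delta_le_hausdorff1 _ e0).
apply: le_ereal_inf_tmp => _ [F [ABF Fe] <-].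
pose G C k := if `[< F k `&` C !=set0 >] then F k else set0.
have Gle C k : ediam (G C k) <= e%:E.
  by rewrite /G; case: ifP => // _; rewrite ediam0 lee_fin ltW.
have GC C : C `<=` A `|` B -> C `<=` \bigcup_k G C k.
  move=> CAB x Cx; have [k _ Fkx] := ABF _ (CAB _ Cx).
  by exists k => //; rewrite /G; case: asboolP => // -[]; exists x.
have dF k : ediam (G A k) + ediam (G B k) <= ediam (F k).
  rewrite /G; case: asboolP => [[x [Fx Ax]]|_]; last first.
    by rewrite ediam0 add0e; case: ifP => // _; rewrite ediam0 ediam_ge0.
  case: asboolP => [[y [Fy By]]|_]; last by rewrite ediam0 adde0.
  have := le_trans (le_ediam Fx Fy) (Fe k).
  rewrite lee_fin leNgt (lt_le_trans _ (ABd _ _ Ax By))//.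
  by rewrite /e gt_min; apply/orP; right; lra.
apply: (@le_trans _ _ (\sum_(k <oo) (ediam (G A k) + ediam (G B k)))); last first.
  by apply: lee_nneseries => k _; [rewrite adde_ge0// ediam_ge0|exact: dF].
rewrite nneseriesD; [|by move=> *; exact: ediam_ge0..].
apply: leeD; apply: ereal_inf_lbound.
  exists (G A) => //; split; first by apply: GC; left.
  by move=> k; rewrite (le_trans (Gle _ _))// lee_fin !ge_min lexx.
exists (G B) => //; split; first by apply: GC; right.
by move=> k; rewrite (le_trans (Gle _ _))// lee_fin !ge_min lexx orbT.
Qed.

Lemma hausdorff1_separated A B (d : R) : (0 < d)%R ->
  (forall x y, A x -> B y -> (d <= enorm (x - y))%R) ->
  mu A + mu B <= mu (A `|` B).
Proof.
move=> d0 ABd.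
have [->|ABoo] := eqVneq (mu (A `|` B)) +oo; first by rewrite leey.
have fAB : mu (A `|` B) \is a fin_num.
  by rewrite fin_numE ABoo andbT gt_eqF// (lt_le_trans _ (hausdorff1_ge0 _)).
have fS C : C `<=` A `|` B -> mu C \is a fin_num.
  move=> CAB; rewrite ge0_fin_numE ?hausdorff1_ge0//.
  by rewrite (le_lt_trans (le_hausdorff1 CAB))// ltey.
rewrite -leeBrDr ?fS//; apply: ge_ereal_sup => _ [d1 /= d10 <-].
have fA : hausdorff1_delta d1 A \is a fin_num.
  rewrite ge0_fin_numE ?hausdorff1_delta_ge0//.
  rewrite (le_lt_trans (hausdorff1_delta_le_hausdorff1 A d10))//.
  by rewrite -ge0_fin_numE ?hausdorff1_ge0// fS.
rewrite leeBrDr ?fS// addeC -leeBrDr//.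
apply: ge_ereal_sup => _ [d2 /= d20 <-]; rewrite leeBrDr// addeC.
exact: (hausdorff1_delta_separated d0).
Qed.

(** [g] will be the distance to the complement of an open set. The Lipschitz bound turns a gap
    between two values of [g] into a distance between points. [Y] collects superlevel sets
    increasing to the part of [X] where [g] is positive, and [S] the annuli between consecutive
    levels. *)
Variable g : V -> R.
Hypothesis glip : forall x y, (`|g x - g y| <= enorm (x - y))%R.
Variable X : set V.
Let a (k : nat) : R := k.+1%:R^-1.
Let Y k := X `&` [set x | (a k < g x)%R].
Let S k := X `&` [set x | (a k.+1 < g x <= a k)%R].

Let a_gt0 k : (0 < a k)%R. Proof. by rewrite invr_gt0. Qed.
Let a_dec k : (a k.+1 < a k)%R.
Proof. by rewrite ltf_pV2 ?posrE// ltr_nat. Qed.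

Let superlevel_sep (A B : set V) (c d : R) : (c < d)%R ->
  (forall x, A x -> d <= g x)%R -> (forall y, B y -> g y <= c)%R ->
  mu A + mu B <= mu (A `|` B).
Proof.
move=> cd Ad Bc; apply: (@hausdorff1_separated _ _ (d - c)).
  by rewrite subr_gt0.
move=> x y Ax By; rewrite (le_trans _ (glip x y))// (le_trans _ (ler_norm _))//.
by rewrite lerB ?Ad ?Bc.
Qed.

(* Annuli of the same parity are at positive distance from each other, so their
   measures add up. *)
Let sum_annuli (b : bool) N :
  (\sum_(0 <= k < N | odd k == b) mu (S k) <= mu (Y N)) /\
  (odd N == b -> \sum_(0 <= k < N | odd k == b) mu (S k) <= mu (Y N.-1)).
Proof.
(* The second bound is the one that drives the induction: when [N] has the parity of the sum, the
   last annulus counted is [S (N - 2)], contained in [Y (N - 1)], and the levels [a (N - 1)] and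
   [a N] separate the latter from [S N]. *)
elim: N => [|N [ih1 ih2]]; first by rewrite big_geq// !hausdorff1_ge0.
have YS k : Y k `<=` Y k.+1.
  by move=> x [Xx /= h]; split => //=; rewrite (lt_trans (a_dec k)).
have SY k : S k `<=` Y k.+1 by move=> x [Xx /= /andP[]].
rewrite big_mkcond big_nat_recr//= -big_mkcond/=.
case: ifPn => [Nb|Nb]; last first.
  by rewrite adde0; split => [|_]//; apply: le_trans ih1 (le_hausdorff1 (YS _)).
split; last by move: Nb => /eqP <-; case: (odd N).
have := ih2 Nb; case: N {ih1 ih2 Nb} => [|N] ih.
  by rewrite big_geq// add0e le_hausdorff1.
apply: (le_trans (leeD2r _ ih)) => /=.
apply: (@le_trans _ _ (mu (Y N `|` S N.+1))); last first.
  apply: le_hausdorff1 => x [|]; last exact: SY.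
  by move=> /YS/YS.
apply: (superlevel_sep (a_dec N)) => x [_ /=]; first exact: ltW.
by case/andP.
Qed.

Let annuli_summable : mu X < +oo -> \sum_(k <oo) mu (S k) < +oo.
Proof.
move=> Xoo; apply: (@le_lt_trans _ _ (mu X + mu X)); last exact: lte_add_pinfty.
apply: lime_le; first by apply: is_cvg_nneseries => k _ _; exact: hausdorff1_ge0.
apply: nearW => N.
rewrite (bigID (fun k => odd k == true))/=.
apply: leeD.
  apply: (le_trans (sum_annuli true N).1); apply: le_hausdorff1.
  exact: subIsetl.
rewrite (eq_bigl (fun k => odd k == false)); last by move=> k; case: (odd k).
apply: (le_trans (sum_annuli false N).1); apply: le_hausdorff1.
exact: subIsetl.
Qed.

Let superlevel_cover N :
  X `&` [set x | (0 < g x)%R] `<=` Y N `|` \bigcup_(k in ~` `I_N) S k.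
Proof.
move=> x [Xx /= gx].
have [aNx|] := ltP (a N) (g x); first by left.
have [M aM] : exists M, (a M < g x)%R.
  exists (Num.truncn (g x)^-1); rewrite /a invf_plt ?posrE//.
  exact: truncnS_gt.
move=> xN; right.
(* The least [m] with [a m < g x] puts [x] into the annulus of index [m - 1]; it is not 0 because
   [g x <= a N <= a 0]. *)
have ex : exists m, (a m < g x)%R by exists M.
case: (ex_minnP ex) => -[|m] am mmin.
  have : (a N <= a 0)%R by rewrite lef_pV2 ?posrE// ler_nat.
  by rewrite leNgt (lt_le_trans am).
exists m; last first.
  split => //=; rewrite am/= leNgt; apply/negP => /mmin.
  by rewrite ltnn.
rewrite /= ; apply/negP; rewrite -leqNgt; apply: contraT.
rewrite -ltnNge => mN.
have : (a N <= a m.+1)%R by rewrite lef_pV2 ?posrE// ler_nat ltnS.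
by rewrite leNgt (lt_le_trans am).
Qed.

(** [Y N] is at positive distance from the points of [X] where [g] is not positive, so these two
    measures add up. What is left out is covered by the annuli from [N] on, whose measure is the
    tail of a convergent series. *)
Lemma hausdorff1_superlevel_split :
  mu (X `&` [set x | (0 < g x)%R]) + mu (X `&` ~` [set x | (0 < g x)%R]) <= mu X.
Proof.
have [->|Xoo] := eqVneq (mu X) +oo; first by rewrite leey.
have {}Xoo : mu X < +oo by rewrite ltey.
set P := [set x | _].
apply/lee_addgt0Pr => e e0.
have := nneseries_tail_cvg (annuli_summable Xoo)
  (fun k _ => hausdorff1_ge0 (S k)).
move=> /fine_cvgP[fint /cvgrPdist_lt/(_ _ e0) tail].
near \oo => N.
have tN : \sum_(N <= k <oo) mu (S k) \is a fin_num by near: N.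
have te : \sum_(N <= k <oo) mu (S k) <= e%:E.
  rewrite -(fineK tN) lee_fin.
  have : (`|0 - fine (\sum_(N <= k <oo) mu (S k))| < e)%R by near: N.
  by rewrite sub0r normrN => /ltW; apply: le_trans; exact: ler_norm.
move: tN te; set t := (X in X \is a fin_num) => tN te.
have h1 : mu (X `&` P) <= mu (Y N) + t.
  apply: (le_trans (le_hausdorff1 (@superlevel_cover N))).
  apply: (le_trans (outer_measureU2 _ _ _)); apply: leeD2l.
  exact: outer_measure_sigma_subadditive_tail.
apply: (le_trans (leeD2r _ h1)); rewrite -addeA (addeC t) addeA.
apply: leeD => //.
apply: (@le_trans _ _ (mu (Y N `|` X `&` ~` P))); last first.
  by apply: le_hausdorff1; rewrite subUset; split; exact: subIsetl.
apply: (superlevel_sep (a_gt0 N)) => x [_ /=]; first exact: ltW.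
by move/negP; rewrite -leNgt.
Unshelve. all: by end_near. Qed.

End metric_outer_measure.

(** * Borel sets are Caratheodory measurable *)

Section borel_measurable.
Context {R : realType} {n : nat}.
Local Notation V := 'rV[R]_n.
Implicit Types (U C : set V) (x y : V).

Lemma lipschitz_superlevel_measurable (g : V -> R) :
  (forall x y, `|g x - g y| <= enorm (x - y)) ->
  measurable ([set x | 0 < g x] : set (H1space R n)).
Proof.
move=> glip; apply: le_caratheodory_measurable => X.
exact: hausdorff1_superlevel_split.
Qed.

Let dist C x : R := inf [set enorm (x - y) | y in C].

Let dist_lb C x : has_lbound [set enorm (x - y) | y in C].
Proof. by exists 0 => _ [y _ <-]; exact: enorm_ge0. Qed.

Let dist_le C x y : C !=set0 -> dist C x <= dist C y + enorm (x - y).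
Proof.
move=> [c Cc]; rewrite -lerBlDr; apply: lb_le_inf; first by exists (enorm (y - c)), c.
move=> _ [z Cz <-]; rewrite lerBlDr addrC.
apply: (@le_trans _ _ (enorm (x - z))).
  by apply: ge_inf; [exact: dist_lb|exists z].
by rewrite -[x - z](subrKA y) ler_enormD.
Qed.

Lemma open_measurable_H1 U : open U -> measurable (U : set (H1space R n)).
Proof.
(* The whole space is set apart: the distance to its empty complement is an infimum over the empty
   set, 0 by default, and its positivity set would be empty. *)
move=> oU; have [C0|/set0P C0] := eqVneq (~` U) set0.
  by rewrite -(setCK U) C0 setC0; exact: measurableT.
rewrite (_ : U = [set x | 0 < dist (~` U) x]).
  apply: lipschitz_superlevel_measurable => x y.
  rewrite ler_norml lerBlDl dist_le// andbT lerNl opprB lerBlDl.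
  by rewrite enorm_distC dist_le.
apply/seteqP; split => x /=.
  move=> Ux; have [e e0 eU] := nbhs_eball (open_nbhs_nbhs (conj oU Ux)).
  apply: (lt_le_trans e0); apply: lb_le_inf.
    by case: C0 => c Cc; exists (enorm (x - c)), c.
  move=> _ [y Uy <-]; rewrite leNgt; apply/negP => xy; apply: Uy; apply: eU.
  by rewrite /eball /= enorm_distC.
apply: contraPP => Ux; apply/negP; rewrite -leNgt.
by apply: ge_inf; [exact: dist_lb|exists x => //; rewrite subrr enorm0].
Qed.

Lemma closed_measurable_H1 C : closed C -> measurable (C : set (H1space R n)).
Proof.
move=> cC; rewrite -(setCK C); apply: measurableC.
by apply: open_measurable_H1; exact: closed_openC.
Qed.

Lemma borel_measurable_H1 U : borel U -> measurable (U : set (H1space R n)).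
Proof.
move=> bU; apply: (bU (measurable : set (set (H1space R n)))); split.
  exact: sigma_algebra_measurable.
by move=> A; exact: open_measurable_H1.
Qed.

Lemma open_borel U : open U -> borel U.
Proof. by move=> oU; exact: sub_sigma_algebra. Qed.

Lemma borelC U : borel U -> borel (~` U).
Proof. by move=> bU; rewrite -setTD; exact: sigma_algebraCD. Qed.

Lemma borelI U C : borel U -> borel C -> borel (U `&` C).
Proof.
move=> bU bC.
exact: (@measurableI _ (g_sigma_algebraType [set U : set V | open U]) U C bU bC).
Qed.

Lemma continuous_measurable_H1 (g : V -> R) (D : set V) : continuous g ->
  measurable (D : set (H1space R n)) ->
  measurable_fun (D : set (H1space R n)) (g : H1space R n -> R).
Proof.
move=> cg mD.
apply: (measurability (@RGenOpens.G R)); first exact: RGenOpens.measurableE.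
move=> _ [_ [a [b ->]] <-]; apply: measurableI => //; apply: open_measurable_H1.
by have /continuousP := cg; apply; exact: interval_open.
Qed.

End borel_measurable.

(** * Length and integration along a line *)

Section hausdorff1_line.
Context {R : realType} {n : nat}.
Local Notation V := 'rV[R]_n.
Local Notation mu := (@hausdorff1 R n).
Local Notation lambda := (@lebesgue_measure R).
Variables (p v : V).
Hypothesis v1 : enorm v = 1.
Let iota (s : R) : V := p + s *: v.
Let pi (x : V) : R := dot (x - p) v.

Let enorm_iota s s' : enorm (iota s - iota s') = `|s - s'|.
Proof. by rewrite /iota opprD addrACA subrr add0r -scalerBl enormZ v1 mulr1. Qed.

Let iotaK s : pi (iota s) = s.
Proof. by rewrite /pi /iota addrC addKr dotZl dot_unit// mulr1. Qed.

(** [T] lies in an interval of length [d] starting at its infimum. It is not assumed measurable,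
    because the sets of a Hausdorff cover are arbitrary; [lambda] then acts as an outer measure. *)
Let lambda_le (T : set R) : (lambda T <= ediam (iota @` T))%E.
Proof.
have [->|/set0P [s0 Ts0]] := eqVneq T set0.
  by rewrite image_set0 ediam0 measure0.
case E : (ediam _) (ediam_ge0 (iota @` T)) => [d| |]; last 2 first.
- by move=> _; rewrite leey.
- by rewrite leeNy_eq.
rewrite lee_fin => d0.
have Td s s' : T s -> T s' -> `|s - s'| <= d.
  move=> Ts Ts'; rewrite -lee_fin -E -enorm_iota.
  by apply: le_ediam; [exists s|exists s'].
have lbT : lbound T (s0 - d).
  by move=> s Ts; rewrite lerBlDl -lerBlDr (le_trans (ler_norm _))// Td.
have -> : d%:E = lambda `[inf T, inf T + d].
  rewrite lebesgue_measure_itv/= lte_fin ltrDl.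
  have [_|] := ltP 0 d; first by rewrite -EFinB addrC addKr.
  by move=> d0'; congr EFin; apply/eqP; rewrite eq_le d0 d0'.
apply: (@le_mu_ext _ _ _ (wlength idfun)) => s Ts /=; rewrite in_itv/=.
apply/andP; split; first by apply: ge_inf => //; exists (s0 - d).
rewrite -lerBlDr; apply: lb_le_inf; first by exists s0.
by move=> s' Ts'; rewrite lerBlDl -lerBlDr (le_trans (ler_norm _))// Td.
Qed.

Let hausdorff1_segment_le (a b : R) : a <= b ->
  (mu (iota @` [set s | a <= s <= b]%R) <= (b - a)%:E)%E.
Proof.
move=> ab; apply: ge_ereal_sup => _ [d /= d0 <-].
pose N := (Num.truncn ((b - a) / d)).+1.
pose h := (b - a) / N%:R.
have N0 : 0 < N%:R :> R by rewrite ltr0n.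
have h0 : 0 <= h by rewrite divr_ge0 ?subr_ge0// ltW.
have hd : h <= d.
  by rewrite ler_pdivrMr// mulrC -ler_pdivrMr// ltW// truncnS_gt.
pose F (k : nat) : set V := if (k < N)%N then
  iota @` [set s | a + k%:R * h <= s <= a + k.+1%:R * h] else set0.
have Fh k : (ediam (F k) <= h%:E)%E.
  rewrite /F; case: ifP => _; last by rewrite ediam0 lee_fin.
  apply: ediam_le => // _ _ [s /= /andP[s1 s2] <-] [s' /= /andP[s1' s2'] <-].
  rewrite enorm_iota ler_norml.
  have : k.+1%:R = k%:R + 1 :> R by rewrite -natr1.
  by move=> E; rewrite E in s2 s2'; nra.
apply: (@le_trans _ _ (\sum_(k <oo) ediam (F k))%E).
  apply: ereal_inf_lbound; exists F => //; split; last first.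
    by move=> k; rewrite (le_trans (Fh k))// lee_fin.
  move=> _ [s /= /andP[as_ sb] <-].
  have [hE|hn0] := eqVneq h 0.
    have ba : a = b.
      move: hE => /eqP; rewrite mulf_eq0 invr_eq0 (gt_eqF N0) orbF subr_eq0.
      by move=> /eqP.
    exists 0%N => //; rewrite /F /=; exists s => //=.
    by rewrite hE !mulr0 !addr0 as_/= ba.
  have {}h0 : 0 < h by rewrite lt_def hn0.
  have bE : b = a + N%:R * h by rewrite /h; field; rewrite gt_eqF.
  (* Truncation would assign the right endpoint the index [N], one past the last piece. *)
  have [sb'|] := eqVneq s b.
    exists N.-1 => //; rewrite /F ltn_predL/=.
    exists s => //=; apply/andP; split.
      by rewrite sb' [leRHS]bE lerD2l ler_wpM2r ?(ltW h0)// ler_nat leqnSn.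
    by rewrite sb' [leLHS]bE.
  rewrite -subr_eq0 => snb.
  have k0 : 0 <= (s - a) / h by rewrite divr_ge0 ?subr_ge0// ltW.
  exists (Num.truncn ((s - a) / h)) => //; rewrite /F.
  have /andP[k1 k2] := truncn_itv k0.
  rewrite ifT; last first.
    rewrite -(ltr_nat R) (le_lt_trans k1)// ltr_pdivrMr// ltrBlDl -bE.
    by rewrite lt_neqAle sb andbT -subr_eq0.
  exists s => //=; rewrite -lerBrDl -ler_pdivlMr// k1/=.
  by rewrite -lerBlDl -ler_pdivrMr// ltW.
rewrite (@nneseries_split _ _ 0 N); last by move=> k _; exact: ediam_ge0.
rewrite [X in (_ + X)%E]eseries0 ?adde0; last first.
  by move=> k Nk _; rewrite /F ltnNge Nk/= ediam0.
rewrite add0n (@le_trans _ _ (\sum_(0 <= k < N) h%:E)%E)//.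
  by apply: lee_sum => k _; exact: Fh.
rewrite sumEFin lee_fin big_const_nat subn0 iter_addr_0 -mulr_natr.
by rewrite mulfVK// gt_eqF.
Qed.

(** Interval covers of [S] map to covers by segments, which gives one inequality. For the other, the
    preimages of any cover of the image cover [S] and have outer Lebesgue measure at most the
    diameters; this works at every mesh, so mesh 1 is enough. *)
Lemma hausdorff1_line (S : set R) : mu (iota @` S) = lambda S.
Proof.
apply/eqP; rewrite eq_le; apply/andP; split.
  apply: le_ereal_inf_tmp => _ [A [mA SA] <-].
  apply: (@le_trans _ _ (\sum_(k <oo) mu (iota @` A k))%E).
    apply: le_trans (hausdorff1_sigma_subadditive _); apply: le_hausdorff1.
    by move=> _ [s /SA[k _ Aks] <-]; exists k => //; exists s.
  apply: lee_nneseries => k _; first by move=> _; exact: hausdorff1_ge0.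
  have /ocitvP[->|[[a b] /= ab ->]] := mA k.
    by rewrite image_set0 hausdorff10; exact: wlength_ge0.
  rewrite wlength_itv_bnd ?(ltW ab)//=.
  apply: le_trans (hausdorff1_segment_le (ltW ab)).
  apply: le_hausdorff1; apply: image_subset => s /=.
  by rewrite in_itv/= => /andP[/ltW -> ->].
apply: (@le_trans _ _ (hausdorff1_delta 1 (iota @` S))); last first.
  exact: hausdorff1_delta_le_hausdorff1.
apply: le_ereal_inf_tmp => _ [F [SF _] <-].
apply: (@le_trans _ _ (\sum_(k <oo) lambda (iota @^-1` F k))%E).
  apply: (le_trans _ (outer_measure_sigma_subadditive (wlength idfun)^*%mu _)).
  apply: (@le_mu_ext _ _ _ (wlength idfun)) => s Ss.
  by have [k _ Fk] := SF _ (imageP _ Ss); exists k.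
apply: lee_nneseries => [k _ _|k _].
  exact: (outer_measure_ge0 (wlength idfun)^*%mu).
apply: (le_trans (lambda_le _)); apply: ge_ereal_sup => d [->|].
  exact: ediam_ge0.
move=> [[_ _] /= [[s Fs <-] [s' Fs' <-]] <-].
exact: le_ediam.
Qed.

Let pi_continuous : continuous pi.
Proof.
move=> x; rewrite /pi.
apply: (@continuous_comp V V R (fun x : V => x - p) (fun x : V => dot x v)).
  by apply: (@cvgB _ _ _ (nbhs x)); [exact: cvg_id|exact: cvg_cst].
exact: dot_continuous.
Qed.

(** The whole line is closed, as the set of points equal to their own projection, and [T] is
    selected on it by the continuous coordinate [pi]. *)
Lemma measurable_line_image (T : set R) : measurable T ->
  measurable (iota @` T : set (H1space R n)).
Proof.
move=> mT.
have mpi : measurable_fun setT (pi : H1space R n -> R).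
  exact: continuous_measurable_H1.
pose C : set V := [set x | enorm (x - p - pi x *: v) <= 0].
have cC : closed C.
  have /continuous_closedP : continuous (fun x : V => enorm (x - p - pi x *: v)).
    move=> x; apply: (@continuous_comp V V R (fun x : V => x - p - pi x *: v)
      (@enorm R n)); last exact: enorm_continuous.
    apply: (@cvgB _ _ _ (nbhs x)).
      by apply: (@cvgB _ _ _ (nbhs x)); [exact: cvg_id|exact: cvg_cst].
    by apply: (@cvgZr_tmp _ _ _ (nbhs x)); exact: pi_continuous.
  by move=> /(_ [set s | s <= 0]); apply; exact: closed_le.
rewrite (_ : iota @` T = C `&` (setT `&` pi @^-1` T)).
  apply: measurableI; first exact: closed_measurable_H1.
  exact: mpi.
apply/seteqP; split => [_ [s Ts <-]|x [Cx [_ Tx]]].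
  split; last by split => //=; rewrite iotaK.
  by rewrite /C /= iotaK /iota (addrC p) addrK subrr enorm0.
exists (pi x) => //.
have /enorm_eq0/eqP : enorm (x - p - pi x *: v) = 0.
  by apply/eqP; rewrite eq_le enorm_ge0 andbT.
by rewrite subr_eq0 subr_eq => /eqP E; rewrite /iota addrC; exact: esym E.
Qed.

Variables (T : set R) (c : R).
Hypothesis mT : measurable T.
Hypothesis Tc : ~ T c.
Variable g : V -> R.
Hypothesis cg : continuous g.
Hypothesis ig : lambda.-integrable T (fun s => (g (iota s))%:E).

Let mD : measurable (iota @` T : set (H1space R n)).
Proof. exact: measurable_line_image. Qed.

(* The coordinate along the line; points off iota @` T are sent to c, outside
   T, so that T pulls back to iota @` T exactly. *)
Let coord (x : H1space R n) : measurableTypeR R :=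
  c + (pi x - c) * \1_(iota @` T) x.

Let measurable_coord : measurable_fun setT coord.
Proof.
apply: measurable_funD; first exact: measurable_cst.
apply: measurable_funM.
  apply: measurable_funB; last exact: measurable_cst.
  exact: (@continuous_measurable_H1 _ _ pi).
exact: measurable_indic.
Qed.

Let coord_iota s : T s -> coord (iota s) = s.
Proof.
move=> Ts; rewrite /coord indicE mem_set; last by exists s.
by rewrite mulr1 iotaK addrC subrK.
Qed.

Let coord_preimage A : A `<=` T -> coord @^-1` A = iota @` A.
Proof.
move=> AT; apply/seteqP; split => [x|_ [s As <-]]; last first.
  by rewrite /= coord_iota//; exact: AT.
rewrite /coord /preimage/= indicE.
have [Dx|Dx] := pselect ((iota @` T) x); last first.
  by rewrite memNset// mulr0 addr0 => /AT.
rewrite mem_set//; case: Dx => s Ts <-.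
by rewrite iotaK mulr1 addrC subrK => As; exists s.
Qed.

Let gm : measurable_fun setT (fun s : measurableTypeR R => (g (iota s))%:E).
Proof.
apply/measurable_EFinP; apply: continuous_measurable_fun => s.
apply: (@continuous_comp _ _ _ iota g); last exact: cg.
apply: cvgD; first exact: cvg_cst.
by apply: cvgZr_tmp; exact: cvg_id.
Qed.

Let pushE A : measurable A -> A `<=` T ->
  pushforward (H1 R n) coord A = lambda A.
Proof. by move=> mA AT; rewrite /pushforward/= coord_preimage// hausdorff1_line. Qed.

Let integral_push (f : R -> \bar R) :
  (\int[pushforward (H1 R n) coord]_(s in T) f s = \int[lambda]_(s in T) f s)%E.
Proof.
by apply: eq_measure_integral; exact: pushE.
Qed.

(** Change of variables along [coord], which is measurable on the whole space: its image measure
    agrees with [lambda] on the measurable subsets of [T]. *)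
Lemma integrable_line : (H1 R n).-integrable (iota @` T) (EFin \o g).
Proof.
apply/integrableP; split.
  by apply/measurable_EFinP; exact: continuous_measurable_H1.
rewrite (@eq_integral _ _ _ _ _
  ((fun s => `|(g (iota s))%:E|%E) \o coord)); last first.
  by move=> x /[!inE] -[s Ts <-]; rewrite /= coord_iota.
rewrite -{1}(@coord_preimage T)//.
rewrite -ge0_integral_pushforward//=; last first.
  exact: (measurable_funTS (measurableT_comp (@abse_measurable R setT) gm)).
rewrite integral_push.
by case/integrableP : ig.
Qed.

Lemma integral_line :
  (\int[H1 R n]_(x in iota @` T) (g x)%:E =
   \int[lambda]_(s in T) (g (iota s))%:E)%E.
Proof.
rewrite (@eq_integral _ _ _ _ _ ((fun s => (g (iota s))%:E) \o coord)); last first.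
  by move=> x /[!inE] -[s Ts <-]; rewrite /= coord_iota.
rewrite -{1}(@coord_preimage T)//.
rewrite -integral_pushforward//=.
rewrite coord_preimage//.
apply: eq_integrable integrable_line => //.
by move=> x /[!inE] -[s Ts <-]; rewrite /= coord_iota.
Qed.

End hausdorff1_line.

(** * Directional derivatives and the fundamental theorem of calculus on segments *)

Section directional_derivative.
Context {R : realType} {n : nat}.
Local Notation V := 'rV[R]_n.

Lemma is_derive_line (f : V -> R) (x v : V) (s d : R) :
  is_derive (x + s *: v) v f d <-> is_derive s 1 (fun u : R => f (x + u *: v)) d.
Proof.
have E : (fun h : R => h^-1 *: ((f \o shift (x + s *: v)) (h *: v) - f (x + s *: v))) =
    (fun h => h^-1 *: (((fun u => f (x + u *: v)) \o shift s) (h *: (1 : R)) -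
       f (x + s *: v))).
  apply/funext => h /=; congr (_ *: (f _ - _)).
  by rewrite scalerDl addrCA /GRing.scale/= mulr1.
split=> -[h1 h2]; apply: DeriveDef.
- by move: h1; rewrite /derivable E.
- by move: h2; rewrite /derive E.
- by move: h1; rewrite /derivable -E.
- by move: h2; rewrite /derive -E.
Qed.

Lemma line_continuous (x v : V) : continuous (fun u : R => x + u *: v).
Proof.
move=> s; apply: (@cvgD _ _ _ (nbhs s)); first exact: cvg_cst.
by apply: (@cvgZr_tmp _ _ _ (nbhs s)); exact: cvg_id.
Qed.

Lemma comp_line_continuous (f : V -> R) (x v : V) :
  continuous f -> continuous (fun u : R => f (x + u *: v)).
Proof.
move=> cf s; apply: (@continuous_comp _ _ _ (fun u : R => x + u *: v) f).
  exact: line_continuous.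
exact: cf.
Qed.

Variable f : V -> R.
Hypothesis cf : continuous f.
Hypothesis df : forall j x, derivable f x (delta_mx 0 j).
Hypothesis cdf : forall j, continuous (partial j f).

Let partial_mvt (j : 'I_n) (x : V) (a : R) : exists2 c : R, `|c| <= `|a| &
  f (x + a *: delta_mx 0 j) - f x = a * partial j f (x + c *: delta_mx 0 j).
Proof.
pose e : V := delta_mx 0 j.
have dg (y : V) (s : R) : is_derive s 1 (fun u : R => f (y + u *: e))
    (partial j f (y + s *: e)).
  by apply/is_derive_line; apply: DeriveDef => //; exact: df.
have cg (y : V) (A : set R) : {within A, continuous (fun u : R => f (y + u *: e))}.
  by apply: continuous_subspaceT; exact: comp_line_continuous.
have [a0|a0] := leP 0 a.
  have [c] := MVT_segment a0 (fun s _ => dg x s) (cg _ _).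
  rewrite in_itv/= => /andP[c0 ca]; rewrite scale0r addr0 subr0 => E.
  by exists c; [rewrite !ger0_norm|rewrite -/e E mulrC].
have [c] := MVT_segment (ltW a0) (fun s _ => dg x s) (cg _ _).
rewrite in_itv/= => /andP[ac c0]; rewrite scale0r addr0 sub0r => E.
exists c; first by rewrite !ler0_norm ?(ltW a0)// lerN2.
by rewrite -/e -opprB E mulrN opprK mulrC.
Qed.

Let trunc (w : V) (k : nat) : V := \row_(j < n) if (j < k)%N then w 0 j else 0.

Let truncS (w : V) (k : 'I_n) : trunc w k.+1 = trunc w k + w 0 k *: delta_mx 0 k.
Proof.
apply/rowP => j; rewrite !mxE eqxx/= ltnS leq_eqVlt.
have [->|/negPf jk] := eqVneq j k; first by rewrite eqxx ltnn/= mulr1 add0r.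
by rewrite (val_eqE j k) jk/= mulr0 addr0.
Qed.

Let norm_trunc (w : V) k : `|trunc w k| <= `|w|.
Proof.
rewrite [leLHS]/Num.norm /= mx_normrE; apply/bigmax_leP; split => // -[i j] _ /=.
by rewrite mxE; case: ifP => _; rewrite ?normr0// coord_le_norm.
Qed.

(** Continuous partial derivatives give total differentiability: the increment is split into steps
    along the axes, each handled by the mean value theorem. Test functions come with derivatives
    along the axes only, while segments point in arbitrary directions. *)
Let first_order (x : V) (e : R) : 0 < e -> exists2 d : R, 0 < d &
  forall w : V, `|w| < d ->
  `|f (x + w) - f x - \sum_k w 0 k * partial k f x| <= e * \sum_k `|w 0 k|.
Proof.
move=> e0.
have [d d0 dP] : exists2 d : R, 0 < d &
    forall (y : V) k, `|y| < d -> `|partial k f (x + y) - partial k f x| <= e.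
  have : \forall y \near x, forall k, `|partial k f x - partial k f y| < e.
    apply: (@filter_forall _ _
      (fun k y => `|partial k f x - partial k f y| < e) (nbhs x)) => k.
    by have /cvgr_dist_lt := @cdf k x; apply.
  move=> /nbhs_normP[d /= d0 dP]; exists d => // y k yd.
  rewrite distrC ltW//; apply: dP => /=.
  by rewrite opprD addNKr normrN.
(* The intermediate point differs from [x] by a truncation of [w] plus a multiple of a basis vector,
   each of norm at most that of [w]. *)
exists (d / 2); first by rewrite divr_gt0.
move=> w wd.
have -> : f (x + w) - f x = \sum_(k < n) (f (x + trunc w k.+1) - f (x + trunc w k)).
  rewrite -(big_mkord xpredT (fun k => f (x + trunc w k.+1) - f (x + trunc w k))).
  rewrite telescope_sumr//; congr (f (x + _) - f _).
    by apply/rowP => j; rewrite mxE ltn_ord.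
  rewrite (_ : trunc w 0 = 0) ?addr0//.
  by apply/rowP => j; rewrite !mxE.
rewrite -sumrB mulr_sumr (le_trans (ler_norm_sum _ _ _))//.
apply: ler_sum => k _; rewrite truncS addrA.
have [c cw ->] := partial_mvt k (x + trunc w k) (w 0 k).
rewrite -mulrBr normrM mulrC ler_wpM2r// -addrA dP//.
rewrite (le_lt_trans (ler_normD _ _))// [ltRHS](splitr d) ler_ltD//.
  by rewrite (le_trans (norm_trunc _ _))// ltW.
rewrite normrZ (le_lt_trans _ wd)// (le_trans _ (coord_le_norm w k))//.
by rewrite (le_trans _ cw)// ler_piMr// (le_trans (norm_le_enorm _))// enorm_delta.
Qed.

Lemma derive_sum_partial (x v : V) :
  is_derive x v f (\sum_j v 0 j * partial j f x).
Proof.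
set l := \sum_j _.
suff cl : (fun h : R => h^-1 *: ((f \o shift x) (h *: v) - f x)) @ 0^' --> l.
  by apply: DeriveDef; [apply/cvg_ex; exists l|exact/cvg_lim].
apply/cvgrPdist_le => e e0.
(* The sum is what remains of the error bound after division by [h]; the 1 keeps [C] positive when
   [v] is zero. *)
pose C := 1 + \sum_k `|v 0 k|.
have C0 : 0 < C by rewrite ltr_pwDl// sumr_ge0.
have [d d0 dP] := first_order x (divr_gt0 e0 C0).
near=> h.
have h0 : h != 0 by near: h; exact: nbhs_dnbhs_neq.
have hd : `|h *: v| < d.
  rewrite normrZ (@le_lt_trans _ _ (`|h| * (1 + `|v|)))//.
    by rewrite ler_wpM2l// lerDr.
  rewrite -ltr_pdivlMr ?ltr_pwDl//; near: h.
  by apply: dnbhs0_lt; rewrite divr_gt0// ltr_pwDl.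
have := dP _ hd => {}dP.
have -> : l - h^-1 *: ((f \o shift x) (h *: v) - f x) =
    - h^-1 * (f (x + h *: v) - f x - \sum_k (h *: v) 0 k * partial k f x).
  have -> : l = h^-1 * \sum_k (h *: v) 0 k * partial k f x.
    by rewrite mulr_sumr; apply: eq_bigr => k _; rewrite mxE -mulrA mulKf.
  by rewrite /= (addrC (h *: v)) /GRing.scale/=; ring.
rewrite normrM normrN (le_trans (ler_wpM2l (normr_ge0 _) dP))//.
under eq_bigr do rewrite mxE normrM.
rewrite -mulr_sumr normrV ?unitfE// mulrCA mulKf ?normr_eq0//.
rewrite -mulrA ler_piMr ?(ltW e0)// mulrC ler_pdivrMr// mul1r.
by rewrite /C lerDr.
Unshelve. all: by end_near. Qed.

Lemma is_derive_segment (x v : V) (s : R) :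
  is_derive s 1 (fun u : R => f (x + u *: v)) (\sum_j v 0 j * partial j f (x + s *: v)).
Proof. by apply/is_derive_line; exact: derive_sum_partial. Qed.

Let cgrad (v : V) : continuous (fun x => \sum_j v 0 j * partial j f x).
Proof.
apply: continuous_big => [|j _ x]; first exact: add_continuous.
apply: (@continuousM R V (fun=> v 0 j)); first exact: cst_continuous.
exact: cdf.
Qed.

Lemma integral_gradient_segment (p v : V) (a b : R) : enorm v = 1 -> a < b ->
  (\int[H1 R n]_(x in (fun s : R => p + s *: v)%R @` `]a, b[)
     (\sum_j v 0 j * partial j f x)%:E)%E =
  (f (p + b *: v) - f (p + a *: v))%:E.
Proof.
move=> v1 ab; pose g := fun s : R => \sum_j v 0 j * partial j f (p + s *: v).
have cg : continuous g.
  exact: (@comp_line_continuous (fun x => \sum_j v 0 j * partial j f x)).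
have gi : lebesgue_measure.-integrable `[a, b] (EFin \o g).
  apply: continuous_compact_integrable; first exact: segment_compact.
  exact: continuous_subspaceT.
have gioo : lebesgue_measure.-integrable `]a, b[ (EFin \o g).
  by apply: integrableS gi => //; exact: subset_itv_oo_cc.
have nb : ~ `]a, b[%classic b by rewrite /= in_itv/= ltxx andbF.
rewrite (integral_line v1 (measurable_itv _) nb (@cgrad v) gioo).
have mg (A : set (measurableTypeR R)) :
    measurable_fun A (fun s : measurableTypeR R => (g s)%:E).
  by apply/measurable_EFinP/measurable_funTS; exact: continuous_measurable_fun.
rewrite integral_itv_bndo_bndc//; last exact: mg.
rewrite integral_itv_obnd_cbnd//; last exact: mg.
have cF : continuous (fun s : R => f (p + s *: v)) by exact: comp_line_continuous.
rewrite (@continuous_FTC2 _ g (fun s : R => f (p + s *: v)) a b)//.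
- exact: continuous_subspaceT.
- split; last 2 first.
  + by apply: cvg_at_right_filter; exact: cF.
  + by apply: cvg_at_left_filter; exact: cF.
  by move=> s _; have [] := is_derive_segment p v s.
- move=> s _; rewrite derive1E; have [_ ->] := is_derive_segment p v s.
  by [].
Qed.

End directional_derivative.

(** * The flat function exp(-1/s) and its derivatives *)

Section flat_function.
Context {R : realType}.

(* All derivatives of exp(-1/s), extended by 0 to s <= 0, are linear
   combinations of these functions. *)
Definition flat (k : nat) (s : R) : R :=
  if 0 < s then s^-1 ^+ k * expR (- s^-1) else 0.

Lemma flat_ge0 k s : 0 <= flat k s.
Proof.
rewrite /flat; case: ltP => // s0.
by rewrite mulr_ge0 ?expR_ge0// exprn_ge0// invr_ge0 ltW.
Qed.

Lemma flat_gt0 k s : 0 < s -> 0 < flat k s.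
Proof.
by move=> s0; rewrite /flat s0 mulr_gt0 ?expR_gt0// exprn_gt0// invr_gt0.
Qed.

Lemma flat_eq0 k s : s <= 0 -> flat k s = 0.
Proof. by move=> s0; rewrite /flat ltNge s0. Qed.

(** One term of the exponential series bounds the power [k.+1] of [s^-1] by a factorial times
    [expR s^-1]. This linear decay at 0 is what makes all difference quotients at 0 tend to 0. *)
Lemma flat_le k s : 0 < s -> flat k s <= k.+1`!%:R * s.
Proof.
move=> s0; rewrite /flat s0 expRN ler_pdivrMr ?expR_gt0//.
have si : 0 <= s^-1 by rewrite invr_ge0 ltW.
have := expR_ge1Dxn k si => h.
have f0 : 0 < k.+1`!%:R :> R by rewrite ltr0n fact_gt0.
have {}h : s^-1 ^+ k.+1 <= k.+1`!%:R * expR s^-1.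
  by rewrite -ler_pdivrMl// mulrC (le_trans _ h)// lerDr.
rewrite exprS in h.
by rewrite mulrAC -ler_pdivrMr// mulrC.
Qed.

Lemma is_derive_flat k (s : R) :
  is_derive s 1 (flat k) (flat k.+2 s - k%:R * flat k.+1 s).
Proof.
have [s0|s0|->] := ltgtP s 0.
- rewrite !flat_eq0 ?ltW// mulr0 subr0.
  have := is_derive_cst (0 : R) s (1 : R); apply: near_eq_is_derive.
  by near=> u; rewrite /= flat_eq0// ltW//; near: u; exact: lt_nbhsl.
- have nearE : \near s, s^-1 ^+ k * expR (- s^-1) = flat k s.
    by near=> u; rewrite /flat ifT//; near: u; exact: lt_nbhsr.
  have sn0 : s != 0 by rewrite gt_eqF.
  have di : is_derive s 1 (fun u : R => u^-1) (- s ^- 2 *: 1).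
    by apply: is_deriveV => //; exact: is_derive_id.
  have dX : is_derive s 1 (fun u : R => u^-1 ^+ k)
     ((k%:R * s^-1 ^+ k.-1) *: (- s ^- 2 *: 1)).
    by rewrite -[f in is_derive _ _ f]exprfctE; exact: (is_deriveX k di).
  have dE : is_derive s 1 (fun u : R => expR (- u^-1))
     (expR (- s^-1) * - (- s ^- 2 *: 1)).
    exact: (@is_derive1_comp _ expR (fun u : R => - u^-1)).
  apply: (near_eq_is_derive nearE).
  have := is_deriveM dX dE; set d1 := (X in is_derive _ _ _ X).
  suff -> : d1 = flat k.+2 s - k%:R * flat k.+1 s by [].
  rewrite /d1.
  rewrite /flat s0 /GRing.scale/= !mulr1 opprK -exprVn.
  clear; case: k => [|k] /=.
    by rewrite expr0 !mul0r mulr0 subr0 addr0 mul1r mulrC.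
  by rewrite !exprS; ring.
- rewrite !flat_eq0// mulr0 subr0.
  suff cl :
    (fun h : R => h^-1 *: ((flat k \o shift 0) (h *: 1) - flat k 0)) @ 0^' --> 0.
    by apply: DeriveDef; [apply/cvg_ex; exists 0|exact/cvg_lim].
  apply/cvgrPdist_le => e e0; near=> h.
  rewrite sub0r normrN /= [h *: 1]mulr1 addr0 (flat_eq0 k (lexx 0)) subr0.
  have [h0|h0] := leP h 0.
    by rewrite flat_eq0// scaler0 normr0 ltW.
  (* Dividing by [h] only raises the index, so the linear decay of the next function applies. *)
  have -> : h^-1 *: flat k h = flat k.+1 h.
    by rewrite /flat h0 exprS /GRing.scale/= mulrA.
  rewrite ger0_norm ?flat_ge0// (le_trans (flat_le _ h0))//.
  rewrite mulrC -ler_pdivlMr ?ltr0n ?fact_gt0// ltW//.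
  rewrite (le_lt_trans (ler_norm _))//; near: h.
  by apply: dnbhs0_lt; rewrite divr_gt0// ltr0n fact_gt0.
Unshelve. all: by end_near. Qed.

Lemma flat_continuous k : continuous (flat k).
Proof.
move=> s; apply/differentiable_continuous/derivable1_diffP.
by have [] := is_derive_flat k s.
Qed.

End flat_function.

(** * Functions of class C^k and a smooth cutoff *)

Section continuously_differentiable.
Context {R : realType} {n : nat}.
Local Notation V := 'rV[R]_n.
Implicit Types f g : V -> R.

(** Recursion on the order lets products, inverses and compositions be treated by induction, which
    the condition [smooth] on all iterated partials does not offer directly. *)
Fixpoint Ck (k : nat) (f : V -> R) : Prop :=
  continuous f /\ if k is k'.+1 then
    forall j, (forall x, derivable f x (delta_mx 0 j)) /\ Ck k' (partial j f)
  else True.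

Lemma Ck_continuous k f : Ck k f -> continuous f.
Proof. by case: k => [|k] []. Qed.

Lemma CkS k f : Ck k.+1 f -> Ck k f.
Proof.
elim: k f => [|k ih] f [cf hf]; first by split.
by split=> // j; have [df pf] := hf j; split => //; exact: ih.
Qed.

Lemma Ck_foldr k f (s : seq 'I_n) : Ck (size s + k) f -> Ck k (foldr partial f s).
Proof.
elim: s k => [//|j s ih] k; rewrite [size _]/= addSnnS => /ih[_ /(_ j)[_]]; exact.
Qed.

Lemma smooth_Ck f : (forall k, Ck k f) -> smooth f.
Proof.
move=> hf s; have [cg hg] : Ck 1 (foldr partial f s) by exact: Ck_foldr.
by split=> // j x; have [] := hg j.
Qed.

Lemma Ck_cst k (a : R) : Ck k (cst a).
Proof.
elim: k a => [|k ih] a; split=> //; try exact: cst_continuous.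
move=> j; split; first by move=> x; exact: derivable_cst.
rewrite (_ : partial j (cst a) = cst 0)//.
by apply/funext => x; rewrite /partial derive_cst.
Qed.

Lemma CkD k f g : Ck k f -> Ck k g -> Ck k (fun x => f x + g x).
Proof.
elim: k f g => [|k ih] f g [cf hf] [cg hg].
  by split=> // x; apply: (@continuousD _ _ _ f g); [exact: cf|exact: cg].
split; first by move=> x; apply: (@continuousD _ _ _ f g); [exact: cf|exact: cg].
move=> j; have [df pf] := hf j; have [dg pg] := hg j; split.
  by move=> x; exact: (@derivableD _ _ _ f g).
rewrite (_ : partial j _ = fun x => partial j f x + partial j g x); first exact: ih.
by apply/funext => x; exact: (@deriveD _ _ _ f g).
Qed.

Lemma CkM k f g : Ck k f -> Ck k g -> Ck k (fun x => f x * g x).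
Proof.
elim: k f g => [|k ih] f g hf hg.
  by split=> // x; apply: (@continuousM _ _ f g); [exact: hf.1|exact: hg.1].
split.
  move=> x; apply: (@continuousM _ _ f g).
    exact: (Ck_continuous hf).
  exact: (Ck_continuous hg).
move=> j; have [df pf] := hf.2 j; have [dg pg] := hg.2 j; split.
  by move=> x; exact: (@derivableM _ _ f g).
rewrite (_ : partial j _ = fun x => f x * partial j g x + g x * partial j f x).
  by apply: CkD; apply: ih => //; exact: CkS.
by apply/funext => x; exact: (@deriveM _ _ f g).
Qed.

Lemma CkN k f : Ck k f -> Ck k (fun x => - f x).
Proof.
move=> hf; rewrite (_ : (fun x => - f x) = fun x => cst (-1) x * f x).
  by apply: CkM => //; exact: Ck_cst.
by apply/funext => x; rewrite mulN1r.
Qed.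

Lemma CkV k f : (forall x, f x != 0) -> Ck k f -> Ck k (fun x => (f x)^-1).
Proof.
move=> f0; elim: k => [|k ih] hf.
  by split=> // x; apply: (@continuousV _ _ f) => //; exact: hf.1.
split.
  by move=> x; apply: (@continuousV _ _ f) => //; exact: hf.1.
move=> j; have [df pf] := hf.2 j; split.
  by move=> x; exact: derivableV.
rewrite (_ : partial j _ = fun x => (- (f x)^-1 * (f x)^-1) * partial j f x).
  apply: CkM => //; apply: CkM; last exact: ih (CkS hf).
  by apply: CkN; exact: ih (CkS hf).
apply/funext => x; rewrite [LHS](@deriveV _ _ f)//.
by rewrite [in RHS]mulNr -expr2 exprVn.
Qed.

Lemma is_derive_comp1 (h : R -> R) f (x v : V) (a b : R) :
  is_derive (f x) 1 h a -> is_derive x v f b -> is_derive x v (h \o f) (a * b).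
Proof.
move=> dh df; have x0 : x + 0 *: v = x by rewrite scale0r addr0.
rewrite -x0 in dh df *; have {}df := (is_derive_line f x v 0 b).1 df.
by apply/is_derive_line; exact: (is_derive1_comp dh df).
Qed.

Lemma Ck_flat k m f : Ck k f -> Ck k (fun x => flat m (f x)).
Proof.
elim: k m f => [|k ih] m f hf.
  split=> // x; apply: (@continuous_comp _ _ _ f (flat m)); first exact: hf.1.
  exact: flat_continuous.
split.
  move=> x; apply: (@continuous_comp _ _ _ f (flat m)).
    exact: hf.1.
  exact: flat_continuous.
move=> j; have [df pf] := hf.2 j.
have dc x : is_derive x (delta_mx 0 j) (fun x => flat m (f x))
    ((flat m.+2 (f x) - m%:R * flat m.+1 (f x)) * partial j f x).
  by apply: is_derive_comp1; [exact: is_derive_flat|exact: derivableP].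
split; first by move=> x; have [] := dc x.
rewrite (_ : partial j _ = fun x =>
   (flat m.+2 (f x) + - (cst m%:R x * flat m.+1 (f x))) * partial j f x).
  apply: CkM => //; apply: CkD; first exact: ih (CkS hf).
  by apply: CkN; apply: CkM; [exact: Ck_cst|exact: ih (CkS hf)].
by apply/funext => x; have [_] := dc x.
Qed.

Lemma is_derive_coord (i j : 'I_n) (x : V) :
  is_derive x (delta_mx 0 j) (fun x : V => x 0 i) ((i == j)%:R : R).
Proof.
have x0 : x + 0 *: (delta_mx 0 j : V) = x by rewrite scale0r addr0.
rewrite -x0; apply/is_derive_line.
rewrite (_ : (fun u : R => _) = cst (x 0 i) + (id * cst ((i == j)%:R : R))).
  have := is_deriveD (is_derive_cst (x 0 i) (0 : R) (1 : R))
    (is_deriveM (is_derive_id (0 : R) (1 : R))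
       (is_derive_cst ((i == j)%:R : R) (0 : R) (1 : R))).
  by rewrite add0r /GRing.scale/= mulr0 add0r mulr1.
by apply/funext => u; rewrite !mxE eqxx.
Qed.

Lemma partial_coord (i j : 'I_n) :
  partial j (fun x : V => x 0 i) = cst ((i == j)%:R : R).
Proof. by apply/funext => x; have [_] := is_derive_coord i j x. Qed.

Lemma Ck_coord k (i : 'I_n) : Ck k (fun x : V => x 0 i).
Proof.
case: k => [|k]; split=> //; try exact: coord_continuous.
move=> j; split; first by move=> x; have [] := is_derive_coord i j x.
by rewrite partial_coord; exact: Ck_cst.
Qed.

Lemma Ck_dotxx k : Ck k (fun x : V => dot x x).
Proof.
rewrite /dot.
suff h (s : seq 'I_n) : Ck k (fun x : V => \sum_(i <- s) x 0 i * x 0 i) by exact: h.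
elim: s => [|i s ih].
  rewrite (_ : (fun x : V => _) = cst 0); first exact: Ck_cst.
  by apply/funext => x; rewrite big_nil.
rewrite (_ : (fun x : V => _) =
    fun x : V => x 0 i * x 0 i + \sum_(i <- s) x 0 i * x 0 i).
  by apply: CkD => //; apply: CkM; exact: Ck_coord.
by apply/funext => x; rewrite big_cons.
Qed.

(** The quotient [A / (A + B)]: [A] vanishes outside the larger ball, [B] inside the smaller one,
    and never both since [a < b]. The squared norm is used because it is a polynomial, hence smooth
    at the origin too. *)
Lemma smooth_cutoff (a b : R) : a < b -> exists chi : V -> R,
  [/\ forall k, Ck k chi, forall x, dot x x <= a -> chi x = 1 &
      forall x, b <= dot x x -> chi x = 0].
Proof.
move=> ab.
pose A (x : V) := flat 0 (b + - dot x x); pose B (x : V) := flat 0 (dot x x + - a).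
have AB x : A x + B x != 0.
  rewrite gt_eqF// /A /B; have [xb|bx] := ltP (dot x x) b.
    by rewrite ltr_pwDl ?flat_ge0// flat_gt0// subr_gt0.
  by rewrite ltr_pwDr ?flat_ge0// flat_gt0// subr_gt0 (lt_le_trans ab).
have hA k : Ck k A.
  apply: Ck_flat; apply: CkD; first exact: Ck_cst.
  by apply: CkN; exact: Ck_dotxx.
have hB k : Ck k B.
  by apply: Ck_flat; apply: CkD; [exact: Ck_dotxx|exact: Ck_cst].
exists (fun x => A x * (A x + B x)^-1); split => [k|x xa|x xb].
- by apply: CkM => //; apply: CkV => //; exact: CkD.
- have B0 : B x = 0 by rewrite /B flat_eq0// subr_le0.
  by have := AB x; rewrite B0 addr0 => A0; rewrite mulfV.
- by rewrite {1}/A flat_eq0 ?mul0r// subr_le0.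
Qed.

End continuously_differentiable.

(** * Real-valued integrals against an integrable density *)

Section real_integral.
Context d (T : measurableType d) (R : realType) (mu : {measure set T -> \bar R}).
Variable D : set T.
Hypothesis mD : measurable D.
Implicit Types f g w : T -> R.

Lemma integrable_boundedM (M : R) g w : measurable_fun D g ->
  (forall x, D x -> `|g x| <= M) -> mu.-integrable D (EFin \o w) ->
  mu.-integrable D (EFin \o (fun x => g x * w x)).
Proof.
move=> mg gM iw; have := integrableMr mD mg _ iw; apply.
exists M; split; first exact: num_real.
by move=> y My x Dx /=; rewrite (le_trans (gM _ Dx))// ltW.
Qed.

Lemma integrable_sumR (I : Type) (s : seq I) (P : pred I) (f : I -> T -> R) :
  (forall i, mu.-integrable D (EFin \o f i)) ->
  mu.-integrable D (EFin \o (fun x => \sum_(i <- s | P i) f i x)).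
Proof.
move=> fi; have := @integrable_sum _ _ _ mu D mD I s P (fun i => EFin \o f i)
  (fun i _ => fi i).
by apply: eq_integrable => // x _; rewrite sumEFin.
Qed.

Lemma Rintegral_sum (I : Type) (s : seq I) (P : pred I) (f : I -> T -> R) :
  (forall i, mu.-integrable D (EFin \o f i)) ->
  \int[mu]_(x in D) (\sum_(i <- s | P i) f i x) =
  \sum_(i <- s | P i) \int[mu]_(x in D) f i x.
Proof.
move=> fi; elim: s => [|i s ih].
  under eq_Rintegral do rewrite big_nil.
  by rewrite big_nil Rintegral_cst// mul0r.
under eq_Rintegral do rewrite big_cons.
rewrite big_cons; case: ifP => // _.
by rewrite RintegralD// ?ih//; exact: integrable_sumR.
Qed.

Lemma Rintegral_indicM (E : set T) w :
  \int[mu]_(x in D) (\1_E x * w x) = \int[mu]_(x in D `&` E) w x.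
Proof.
rewrite Rintegral_mkcondr; apply: eq_Rintegral => x _.
by rewrite indicE /patch; case: (x \in E); rewrite ?mul1r ?mul0r.
Qed.

(** The number of positive integers up to [y] is its integer part. *)
Let count_le (N : nat) (y : R) : 0 <= y <= N%:R ->
  let S := \sum_(k < N) (k.+1%:R <= y :> R)%:R : R in S <= y <= S + 1.
Proof.
elim: N => [|N ih] /andP[y0 yN] /=.
  by rewrite big_ord0 y0 add0r (le_trans yN)// ler01.
rewrite big_ord_recr/=; have [yN'|yN'] := leP y N%:R.
  have -> : ((N.+1%:R : R) <= y) = false.
    by apply/negbTE; rewrite -ltNge (le_lt_trans yN')// ltr_nat.
  by rewrite addr0; apply: ih; rewrite y0.
rewrite (eq_bigr (fun=> 1)); last first.
  move=> k _; have -> // : (k.+1%:R : R) <= y.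
  by apply: le_trans (ltW yN'); rewrite ler_nat.
rewrite sumr_const card_ord -natr1 in yN *.
case: (leP (N%:R + 1) y) => h /=.
  by apply/andP; split => //; lra.
by apply/andP; split; lra.
Qed.

(* A bounded function is a uniform limit of combinations of indicators of its
   superlevel sets. *)
Lemma Rintegral_superlevel_eq0 (M : R) g w : measurable_fun D g ->
  (forall x, D x -> `|g x| <= M) -> mu.-integrable D (EFin \o w) ->
  (forall c, \int[mu]_(x in D `&` [set x | c <= g x]) w x = 0) ->
  \int[mu]_(x in D) (g x * w x) = 0.
Proof.
move=> mg; wlog M0 : M / 0 < M => [hw|] gM iw w0.
  have M1 : 0 < `|M| + 1 by rewrite ltr_wpDl.
  apply: (hw _ M1) => // x Dx.
  by rewrite (le_trans (gM x Dx))// (le_trans (ler_norm M))// lerDl.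
pose W := \int[mu]_(x in D) `|w x|.
have mE c : measurable (D `&` [set x | c <= g x]).
  have -> : [set x | c <= g x] = g @^-1` `[c, +oo[%classic.
    by apply/seteqP; split => x /=; rewrite in_itv/= andbT.
  exact: mg.
have intM c : mu.-integrable D
    (EFin \o (fun x => \1_(D `&` [set x | c <= g x]) x * w x)).
  apply: (@integrable_boundedM 1 (\1_(D `&` [set x | c <= g x]))) => //.
  by move=> x _; rewrite indicE; case: (_ \in _); rewrite ?normr1 ?normr0.
have intM0 c : \int[mu]_(x in D) (\1_(D `&` [set x | c <= g x]) x * w x) = 0.
  by rewrite Rintegral_indicM setIA setIid.
(* The superlevel set at [- M] is all of [D]; this disposes of the constant term of the
   approximation. *)
have w00 : \int[mu]_(x in D) w x = 0.
  rewrite -(w0 (- M)); congr Rintegral.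
  apply/seteqP; split => [x Dx|x []//]; split => //=.
  by have := gM x Dx; rewrite ler_norml => /andP[].
have key N : `|\int[mu]_(x in D) (g x * w x)| <= (2 * M) / N.+1%:R * W.
  set h := 2 * M / _.
  have N0 : 0 < N.+1%:R :> R by rewrite ltr0n.
  have h0 : 0 < h by rewrite !mulr_gt0// invr_gt0.
  pose E k := D `&` [set x | - M + k.+1%:R * h <= g x].
  (* [gN] rounds [g] down to the grid of step [h] starting at [- M], so it differs from [g] by at
     most [h]. *)
  pose gN x := - M + \sum_(k < N.+1) h * \1_(E k) x.
  have igw : mu.-integrable D (EFin \o (fun x => g x * w x)).
    exact: integrable_boundedM gM iw.
  have iEw k : mu.-integrable D (EFin \o (fun x => h * (\1_(E k) x * w x))).
    have := integrableZl mD h (intM (- M + k.+1%:R * h)).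
    by apply: eq_integrable => // x _; rewrite /= EFinM.
  have gNE x : gN x * w x = - M * w x + \sum_(k < N.+1) h * (\1_(E k) x * w x).
    rewrite /gN mulrDl mulr_suml; congr (_ + _).
    by apply: eq_bigr => k _; rewrite mulrA.
  have iMw : mu.-integrable D (EFin \o (fun x => - M * w x)).
    have := integrableZl mD (- M) iw.
    by apply: eq_integrable => // x _; rewrite /= EFinM.
  have igNw : mu.-integrable D (EFin \o (fun x => gN x * w x)).
    have : mu.-integrable D (EFin \o (fun x => - M * w x +
        \sum_(k < N.+1) h * (\1_(E k) x * w x))).
      have := integrableD mD iMw (integrable_sumR (index_enum _) xpredT
        (fun k : 'I_N.+1 => iEw k)).
      by apply: eq_integrable => // x _; rewrite /= EFinD.
    by apply: eq_integrable => // x _; rewrite /= gNE.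
  have gN0 : \int[mu]_(x in D) (gN x * w x) = 0.
    under eq_Rintegral do rewrite gNE.
    rewrite RintegralD//; last exact: integrable_sumR.
    rewrite RintegralZl// w00 mulr0 add0r Rintegral_sum//.
    rewrite big1// => k _; rewrite RintegralZl ?intM0 ?mulr0//.
    exact: intM.
  have -> : \int[mu]_(x in D) (g x * w x) = \int[mu]_(x in D) (g x * w x - gN x * w x).
    by rewrite RintegralB// gN0 subr0.
  have idiff : mu.-integrable D (EFin \o (fun x => g x * w x - gN x * w x)).
    have := integrableB mD igw igNw.
    by apply: eq_integrable => // x _; rewrite /= EFinB.
  apply: (le_trans (le_normr_Rintegral mD idiff)).
  have inw : mu.-integrable D (EFin \o (fun x => `|w x|)).
    exact: (integrable_norm iw).
  rewrite -RintegralZl//; apply: le_Rintegral => //.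
  - exact: (integrable_norm idiff).
  - have := integrableZl mD h inw.
    by apply: eq_integrable => // x _; rewrite /= EFinM.
  move=> x Dx; rewrite -mulrBl normrM ler_wpM2r//.
  have gMx := gM x Dx; rewrite ler_norml in gMx; case/andP : gMx => gM1 gM2.
  have yb : 0 <= (g x + M) / h <= N.+1%:R.
    rewrite divr_ge0 ?(ltW h0)//=; last by lra.
    rewrite ler_pdivrMr// /h mulrC mulfVK ?gt_eqF//; lra.
  have /= := count_le yb.
  set S := \sum_(k < _) _ => Sy.
  have -> : gN x = - M + h * S.
    rewrite /gN /S mulr_sumr; congr (_ + _); apply: eq_bigr => k _.
    have kE : (- M + k.+1%:R * h <= g x) = (k.+1%:R <= (g x + M) / h).
      by rewrite ler_pdivlMr// -lerBlDr addrC.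
    congr (_ * _); rewrite indicE -kE; congr ((nat_of_bool _)%:R).
    apply/idP/idP => [/set_mem[]//|kg].
    by apply/mem_set.
  rewrite ler_norml; have hE : h * ((g x + M) / h) = g x + M.
    by rewrite mulrC mulfVK// gt_eqF.
  case/andP: Sy => S1 S2.
  have := ler_wpM2l (ltW h0) S1; have := ler_wpM2l (ltW h0) S2.
  by rewrite hE mulrDr mulr1 => ? ?; apply/andP; split; lra.
apply/eqP; apply: contraT => I0.
have {}I0 : 0 < `|\int[mu]_(x in D) (g x * w x)| by rewrite normr_gt0.
pose N := Num.truncn (2 * M * W / `|\int[mu]_(x in D) (g x * w x)|).
have := key N; rewrite leNgt mulrAC ltr_pdivrMr ?ltr0n//.
by rewrite [X in _ < X]mulrC -ltr_pdivrMr// truncnS_gt.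
Qed.

End real_integral.

(** * Pointwise lower bound for the integrand *)

Section calibration.
Context {R : realType} {n : nat}.
Variables (eta : R) (i : 'I_n).
Hypothesis eta01 : 0 <= eta <= 1.
Local Notation V := 'rV[R]_n.
Implicit Types (t w : V) (b : 'rV[int]_n).

Lemma psiE b w : psi eta b w =
  dot (int_vec b) (int_vec b) + eta * dot (int_vec b) w ^+ 2 :> R.
Proof. by rewrite /psi sqr_enorm. Qed.

Lemma int_vec_scale_delta (z : int) :
  int_vec (z *: delta_mx 0 i : 'rV[int]_n) = z%:~R *: delta_mx 0 i :> V.
Proof. by apply/rowP => j; rewrite !mxE rmorphM/= rmorph_nat. Qed.

Lemma psi_scale_delta (z : int) w :
  psi eta (z *: delta_mx 0 i) w = z%:~R ^+ 2 * (1 + eta * w 0 i ^+ 2).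
Proof.
rewrite /psi int_vec_scale_delta enormZ enorm_delta mulr1 real_normK ?num_real//.
by rewrite dotZl dotC dot_delta; ring.
Qed.

Lemma psi_delta w : psi eta (delta_mx 0 i) w = 1 + eta * w 0 i ^+ 2.
Proof. by rewrite -(scale1r (delta_mx 0 i)) psi_scale_delta expr1n mul1r. Qed.

Let int_ge1 (z : int) : z != 0 -> 1 <= `|z%:~R : R|.
Proof. by move=> z0; rewrite -intr_norm ler1z -gtz0_ge1 normr_gt0. Qed.

Lemma psi_ge b w : enorm w = 1 ->
  `|(b 0 i)%:~R| * (1 + eta * w 0 i ^+ 2) <= psi eta b w.
Proof.
move=> w1; have /andP[eta0 eta1] := eta01.
have wi : 0 <= w 0 i ^+ 2 <= 1.
  by rewrite sqr_ge0/= -(dot_unit w1) sqr_coord_le_dot.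
have ew : 0 <= eta * w 0 i ^+ 2 <= 1.
  by case/andP : wi => ? ?; rewrite mulr_ge0//= mulr_ile1.
have [b0|] := pselect (forall j, j != i -> b 0 j = 0).
  have -> : b = b 0 i *: delta_mx 0 i.
    apply/rowP => j; rewrite !mxE eqxx/=; have [->|/b0 ->] := eqVneq j i.
      by rewrite mulr1.
    by rewrite mulr0.
  rewrite psi_scale_delta ler_wpM2r ?addr_ge0 ?(andP ew).1//.
  rewrite !mxE !eqxx mulr1 -[X in _ <= X]real_normK ?num_real//; set z := b 0 i.
  have [->|/int_ge1 z1] := eqVneq z 0; first by rewrite mulr0z normr0 expr0n.
  by rewrite expr2 ler_peMl.
move=> /existsNP[j /not_implyP[ji /eqP/int_ge1 bj]].
rewrite psiE; set B := int_vec b.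
have BB : (b 0 i)%:~R ^+ 2 + 1 <= dot B B.
  rewrite /dot (bigD1 i)//= (bigD1 j)//= /B /int_vec !mxE -!expr2.
  rewrite lerD2l (@le_trans _ _ ((b 0 j)%:~R ^+ 2))//.
    by rewrite -[leRHS]real_normK ?num_real// exprn_ege1.
  by rewrite lerDl sumr_ge0// => k _; rewrite mxE -expr2 sqr_ge0.
have h0 : 0 <= eta * dot B w ^+ 2 by rewrite mulr_ge0// sqr_ge0.
have : 2 * `|(b 0 i)%:~R : R| <= (b 0 i)%:~R ^+ 2 + 1.
  have := sqr_ge0 (`|(b 0 i)%:~R : R| - 1).
  by rewrite sqrrB real_normK ?num_real//; lra.
have := normr_ge0 ((b 0 i)%:~R : R); case/andP : ew; nra.
Qed.

(* The gradient at t of the 1-homogeneous function |v| + eta v_i^2 / |v|. *)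
Definition calibration t : V :=
  t + eta *: ((2 * t 0 i) *: delta_mx 0 i - (t 0 i ^+ 2) *: t).

Lemma dot_calibration t w : dot (calibration t) w =
  dot t w + eta * (2 * t 0 i * w 0 i - t 0 i ^+ 2 * dot t w).
Proof.
by rewrite /calibration dotDl dotZl dotBl !dotZl (dotC (delta_mx 0 i)) dot_delta.
Qed.

Lemma calibration_self t : enorm t = 1 ->
  dot (calibration t) t = 1 + eta * t 0 i ^+ 2.
Proof. by move=> t1; rewrite dot_calibration dot_unit//; ring. Qed.

(** Without the absolute value, the right side minus the left side equals [(1 - dot t w) * (1 - eta
    * t 0 i ^+ 2) + eta * (w 0 i - t 0 i) ^+ 2], and both factors of the product are nonnegative as
    [eta <= 1]. The absolute value follows by replacing [w] with its opposite. *)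
Lemma calibration_le t w : enorm t = 1 -> enorm w = 1 ->
  `|dot (calibration t) w| <= 1 + eta * w 0 i ^+ 2.
Proof.
have le (u : V) : enorm t = 1 -> enorm u = 1 ->
    dot (calibration t) u <= 1 + eta * u 0 i ^+ 2.
  move=> t1 u1; have /andP[eta0 eta1] := eta01; rewrite dot_calibration.
  have := dot_le_enormM t u; rewrite t1 u1 mulr1 ler_norml => /andP[_ c1].
  have ti : t 0 i ^+ 2 <= 1 by rewrite -(dot_unit t1) sqr_coord_le_dot.
  have h1 : 0 <= eta * (u 0 i - t 0 i) ^+ 2 by rewrite mulr_ge0// sqr_ge0.
  have h2 : eta * t 0 i ^+ 2 <= 1 by rewrite mulr_ile1// sqr_ge0.
  have h3 : 0 <= (1 - dot t u) * (1 - eta * t 0 i ^+ 2).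
    by rewrite mulr_ge0// subr_ge0.
  by rewrite -subr_ge0 (_ : _ - _ = (1 - dot t u) * (1 - eta * t 0 i ^+ 2) +
    eta * (u 0 i - t 0 i) ^+ 2) ?addr_ge0//; ring.
move=> t1 w1; rewrite ler_norml le// andbT lerNl.
have := le (- w) t1; rewrite enormN => /(_ w1).
by rewrite dotC dotNl (dotC w) !mxE sqrrN.
Qed.

(** [s] will be the sign of [beta]; the bound on its absolute value includes the sign 0. *)
Lemma calibration_psi t b w (s : R) : enorm t = 1 -> enorm w = 1 -> `|s| <= 1 ->
  s * ((b 0 i)%:~R * dot (calibration t) w) <= psi eta b w.
Proof.
move=> t1 w1 s1; apply: le_trans (psi_ge b w1).
rewrite (le_trans (ler_norm _))// normrM.
rewrite (le_trans (ler_piMl (normr_ge0 _) s1))// normrM ler_wpM2l//.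
exact: calibration_le.
Qed.

End calibration.

(** * The straight line inside the ball, and the ball of the boundary condition *)

Section line_in_ball.
Context {R : realType} {n : nat}.
Local Notation V := 'rV[R]_n.

Lemma line_Bhalf (t : V) : enorm t = 1 ->
  line t `&` Bhalf = (fun s : R => 0 + s *: t) @` `]- 2^-1, 2^-1[.
Proof.
move=> t1; apply/seteqP; split => [_ [[s _ <-]]|_ [s /= s12 <-]].
  rewrite /Bhalf /eball /= subr0 enormZ t1 mulr1 ltr_norml => s12.
  by exists s; [rewrite /= in_itv|rewrite add0r].
rewrite add0r; split; first by exists s.
by rewrite /Bhalf /eball /= subr0 enormZ t1 mulr1 ltr_norml; rewrite in_itv in s12.
Qed.

Lemma measurable_line_Bhalf (t : V) : enorm t = 1 ->
  measurable (line t `&` Bhalf : set (H1space R n)).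
Proof. by move=> t1; rewrite line_Bhalf//; apply: measurable_line_image. Qed.

Lemma H1_line_Bhalf (t : V) : enorm t = 1 ->
  H1 R n (line t `&` Bhalf) = 1%:E.
Proof.
move=> t1; rewrite line_Bhalf// /H1/= hausdorff1_line//.
rewrite lebesgue_measure_itv/= lte_fin ifT; last by lra.
by rewrite -EFinD; congr EFin; lra.
Qed.

End line_in_ball.

(** The ball of the boundary condition may have any centre, but the cutoff is radial; the norm
    attains on the compact closure a maximum below the radius of [Bhalf]. *)
Lemma eball_sub_centered (R : realType) (n : nat) (c : 'rV[R]_n) (r : R) :
  0 < r -> compact (closure (eball c r)) -> closure (eball c r) `<=` Bhalf ->
  exists2 rho : R, 0 <= rho < 2^-1 & forall x, eball c r x -> enorm x <= rho.
Proof.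
move=> r0 cK KB.
have Kc : closure (eball c r) c.
  by apply: subset_closure; rewrite /eball /= subrr enorm0.
have ce : {within closure (eball c r), continuous (@enorm R n)}.
  by apply: continuous_subspaceT; exact: enorm_continuous.
have [x xK xmax] := @compact_EVT_max _ R (@enorm R n) _ (ex_intro _ _ Kc) cK ce.
exists (enorm x).
  rewrite enorm_ge0/=; have := KB x (set_mem xK).
  by rewrite /Bhalf /eball /= subr0.
by move=> y yr; apply: xmax; apply: mem_set; exact: subset_closure.
Qed.

(** * The boundary condition determines the total mass *)

Section total_multiplicity.
Context {R : realType} {n : nat}.
Local Notation V := 'rV[R]_n.
Local Notation mu := (H1 R n).
Variables (gamma : set V) (theta : V -> 'rV[int]_n) (tau : V -> V).
Variables (b : 'rV[int]_n) (t : V).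
Hypothesis t1 : enorm t = 1.
Hypothesis mdf : Mdf Bhalf gamma theta tau.
Variable i : 'I_n.

Let D0 : set V := line t `&` Bhalf.
Let mB : measurable (Bhalf : set (H1space R n)).
Proof. exact/open_measurable_H1/eball_open. Qed.

Let mG : measurable (gamma : set (H1space R n)).
Proof. by have [_ []] := mdf. Qed.

(** Extension by zero to the ball gives both measures a density with respect to the same measure, so
    their difference is again a single density. *)
Let W (j : 'I_n) : V -> R := (fun x => (theta x 0 i)%:~R * tau x 0 j) \_ gamma.
Let L (j : 'I_n) : V -> R := (fun=> (b 0 i)%:~R * t 0 j) \_ D0.

Lemma integrable_density j : mu.-integrable gamma
  (EFin \o (fun x => (theta x 0 i)%:~R * tau x 0 j)).
Proof.
have [_ _ [tau1 mtau _] itheta _] := mdf.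
have : mu.-integrable gamma (EFin \o (fun x => tau x 0 j * (theta x 0 i)%:~R)).
  apply: (@integrable_boundedM _ _ _ _ _ mG 1 (fun x => tau x 0 j)) => //.
    by move=> x /tau1 <-; exact: coord_le_enorm.
  exact: itheta.
by apply: eq_integrable => // x _; rewrite /= mulrC.
Qed.

Let iW j : mu.-integrable Bhalf (EFin \o W j).
Proof.
have [GB _ _ _ _] := mdf; rewrite /W -restrict_EFin.
apply/integrable_restrict => //. rewrite (setIidr GB).
exact: integrable_density.
Qed.

Let mD0 : measurable (D0 : set (H1space R n)).
Proof. exact: measurable_line_Bhalf. Qed.

Let integrable_D0_cst (a : R) : mu.-integrable D0 (EFin \o (fun=> a)).
Proof.
apply: (@measurable_bounded_integrable _ _ _ mu (cst a) D0 mD0).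
- by rewrite H1_line_Bhalf// ltry.
- exact: measurable_cst.
- exists `|a|; split; first exact: num_real.
  by move=> y ay x _ /=; rewrite ltW.
Qed.

Let iL j : mu.-integrable Bhalf (EFin \o L j).
Proof.
rewrite /L -restrict_EFin; apply/integrable_restrict => //.
by rewrite setIidr; [exact: integrable_D0_cst|move=> x []].
Qed.

Let integral_wrt_gamma j f :
  integral_wrt gamma theta tau i j f = \int[mu]_(x in Bhalf) (f x * W j x).
Proof.
have [GB _ _ _ _] := mdf; rewrite /integral_wrt -{1}(setIidr GB).
rewrite Rintegral_mkcondr; apply: eq_Rintegral => x _.
by rewrite /W /patch; case: ifP => // _; rewrite mulr0.
Qed.

Let integral_wrt_line j f : integral_wrt D0 (fun=> b) (fun=> t) i j f =
  \int[mu]_(x in Bhalf) (f x * L j x).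
Proof.
have DB : D0 `<=` Bhalf by move=> x [].
rewrite /integral_wrt -{1}(setIidr DB).
rewrite Rintegral_mkcondr; apply: eq_Rintegral => x _.
by rewrite /L /patch; case: ifP => // _; rewrite mulr0.
Qed.

Let iM (M : R) (f g : V -> R) : continuous f ->
  (forall x, Bhalf x -> `|f x| <= M) -> mu.-integrable Bhalf (EFin \o g) ->
  mu.-integrable Bhalf (EFin \o (fun x => f x * g x)).
Proof.
move=> cf fM; apply: (integrable_boundedM mB _ fM).
exact: continuous_measurable_H1.
Qed.

Hypothesis near : straight_near_boundary gamma theta tau b t.

(* Testing div mu = 0 against x_k times a cutoff, both for mu and for the
   straight line, shows that the two total masses agree: away from the cutoff
   region the gradient of the test function is e_k, and near the boundary the
   two measures coincide. *)
Lemma total_multiplicity k :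
  \int[mu]_(x in gamma) ((theta x 0 i)%:~R * tau x 0 k) = (b 0 i)%:~R * t 0 k.
Proof.
have [GB _ _ _ div0] := mdf.
have [c [r [r0 cK KB agree]]] := near.
have [rho /andP[rho0 rho1] crho] := eball_sub_centered r0 cK KB.
(* The cutoff is 1 up to radius [rho], hence on the ball [eball c r], and 0 from [rho'] on, which
   keeps the support compact inside [Bhalf]. *)
pose rho' := (rho + 2^-1) / 2.
have rr' : rho ^+ 2 < rho' ^+ 2.
  by rewrite ltr_pXn2r// ?nnegrE /rho'; lra.
have [chi [chiC chi1 chi0]] := smooth_cutoff (n := n) rr'.
pose phi (x : V) := x 0 k * chi x.
have phiC m : Ck m phi by apply: CkM => //; exact: Ck_coord.
have sphi : smooth phi by exact: smooth_Ck.
have supp_le x : phi x != 0 -> enorm x <= rho'.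
  move=> px; rewrite leNgt; apply/negP => hx.
  move: px; rewrite /phi chi0 ?mulr0 ?eqxx//.
  rewrite -sqr_enorm ler_pXn2r ?nnegrE ?enorm_ge0 ?ltW// /rho'; lra.
have supp_sub : closure [set x | phi x != 0] `<=` [set x | enorm (x - 0) <= rho'].
  rewrite [X in _ `<=` X](closure_id _).1; last exact: closed_eball.
  by apply: closure_subset => x /= /supp_le; rewrite subr0.
have test : test_function Bhalf phi.
  split => //.
    apply: subclosed_compact (@compact_eball R n 0 rho') supp_sub.
    exact: closed_closure.
  move=> x /supp_sub /= h; rewrite /Bhalf /eball /= (le_lt_trans h)//.
  by rewrite /rho'; lra.
(* The deviation of the gradient of [phi] from the basis vector of index [k]; it vanishes on
   [eball c r]. *)
pose g (j : 'I_n) (x : V) := partial j phi x - (k == j)%:R.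
have cphi : continuous phi  := (phiC 0%N).1.
have dphi j x : derivable phi x (delta_mx 0 j) by have [_ /(_ j)[]] := phiC 1%N.
have cdphi j : continuous (partial j phi).
  by have [_ /(_ j)[_ []]] := phiC 1%N.
have cg j : continuous (g j).
  move=> x; apply: (@continuousB _ _ _ (partial j phi) (cst (k == j)%:R)).
    exact: cdphi.
  exact: cst_continuous.
have g0 j x : eball c r x -> g j x = 0.
  move=> xc; rewrite /g; apply/eqP; rewrite subr_eq0; apply/eqP.
  have [_ <-] := is_derive_coord k j x.
  apply: near_eq_derive.
  have := open_nbhs_nbhs (conj (@eball_open R n c r) xc).
  apply: filterS => y yc; rewrite /phi chi1 ?mulr1//.
  by rewrite -sqr_enorm ler_pXn2r ?nnegrE ?enorm_ge0//; exact: crho.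
have bound (f : V -> R) : continuous f ->
    exists M : R, forall x, Bhalf x -> `|f x| <= M.
  move=> cf; pose K : set V := [set x | enorm (x - 0) <= 2^-1].
  have cnf : {within K, continuous (fun x : V => `|f x|)}.
    apply: continuous_subspaceT => x.
    apply: (@continuous_comp V R R f (@Num.norm R R)); first exact: cf.
    exact: norm_continuous.
  have K0 : K 0 by rewrite /K /= subrr enorm0.
  have [x0 _ hx0] := compact_EVT_max (ex_intro _ _ K0) (@compact_eball R n 0 2^-1) cnf.
  by exists `|f x0| => x Bx; apply: hx0; apply: mem_set; exact: ltW.
pose w j x := W j x - L j x.
have iw j : mu.-integrable Bhalf (EFin \o w j).
  have := integrableB mB (iW j) (iL j).
  by apply: eq_integrable => // x _; rewrite /= /w EFinB.
have bBall : borel (Bhalf `\` eball c r : set V).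
  rewrite setDE; apply: borelI; first exact: (open_borel (@eball_open R n 0 _)).
  exact: (borelC (open_borel (@eball_open R n c r))).
have mBall : measurable (Bhalf `\` eball c r : set (H1space R n)).
  exact: borel_measurable_H1.
have wE0 j (E : set V) : borel E -> E `<=` Bhalf `\` eball c r ->
    \int[mu]_(x in E) w j x = 0.
  move=> bE EB; have EBh : E `<=` Bhalf by move=> x /EB[].
  rewrite -(setIidr EBh) -Rintegral_indicM.
  have iE f : mu.-integrable Bhalf (EFin \o f) ->
      mu.-integrable Bhalf (EFin \o (fun x => \1_E x * f x)).
    apply: (integrable_boundedM mB (M := 1)).
      by apply: measurable_indic; exact: borel_measurable_H1.
    by move=> x _; rewrite indicE; case: (_ \in _); rewrite ?normr1 ?normr0.
  under eq_Rintegral do rewrite mulrBr.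
  rewrite RintegralB//; [|exact: iE..].
  rewrite -integral_wrt_gamma -integral_wrt_line.
  have /matrixP/(_ i j) := agree E bE EB; rewrite !mxE => ->.
  by rewrite subrr.
(* Only the region where the two measures agree contributes. The agreement is known on Borel sets,
   and the superlevel sets of the continuous [g j] are Borel. *)
have gw0 j : \int[mu]_(x in Bhalf) (g j x * w j x) = 0.
  have [M hM] := bound _ (cg j).
  transitivity (\int[mu]_(x in Bhalf `\` eball c r) (g j x * w j x)).
    rewrite setDE Rintegral_mkcondr; apply: eq_Rintegral => x _.
    rewrite /patch; case: ifPn => //.
    by rewrite notin_setE /setC /= notK => /g0 ->; rewrite mul0r.
  apply: (@Rintegral_superlevel_eq0 _ _ _ mu _ mBall M).
  - exact: continuous_measurable_H1.
  - by move=> x [Bx _]; exact: hM.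
  - by apply: integrableS (iw j) => // x [].
  move=> e; apply: wE0; last by move=> x [].
  apply: borelI => //; rewrite -[X in borel X]setCK; apply: borelC.
  apply: open_borel; apply: closed_openC.
  by have /continuous_closedP/(_ [set s | e <= s]) := @cg j; apply; exact: closed_ge.
(* Along the line the integrand is the derivative of [phi], which vanishes at both ends of the
   diameter. *)
have line0 : \sum_j \int[mu]_(x in Bhalf) (partial j phi x * L j x) = 0.
  pose e := fun s : R => 0 + s *: t.
  have sum_grad x : \sum_j partial j phi x * ((b 0 i)%:~R * t 0 j) =
      (b 0 i)%:~R * \sum_j t 0 j * partial j phi x.
    by rewrite mulr_sumr; apply: eq_bigr => j _; ring.
  have iD0 j : mu.-integrable D0
      (EFin \o (fun x => partial j phi x * ((b 0 i)%:~R * t 0 j))).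
    have [M hM] := bound _ (cdphi j).
    apply: (integrable_boundedM mD0 (M := M)).
    - exact: continuous_measurable_H1.
    - by move=> x [_]; exact: hM.
    exact: integrable_D0_cst.
  under eq_bigr do rewrite -integral_wrt_line /integral_wrt.
  rewrite -Rintegral_sum//; under eq_Rintegral do rewrite sum_grad.
  have iD0' : mu.-integrable D0 (EFin \o (fun x => \sum_j t 0 j * partial j phi x)).
    have ig j : mu.-integrable D0 (EFin \o (fun x => t 0 j * partial j phi x)).
      have [M hM] := bound _ (cdphi j).
      have i1 : mu.-integrable D0 (EFin \o (fun=> t 0 j)).
        exact: (integrable_D0_cst (t 0 j)).
      have := integrable_boundedM mD0 (continuous_measurable_H1 (@cdphi j) mD0)
        (fun x D0x => hM x D0x.2) i1.
      by apply: eq_integrable => // x _; rewrite /= mulrC.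
    exact: integrable_sumR.
  rewrite RintegralZl//.
  rewrite /D0 line_Bhalf// /Rintegral.
  rewrite (@integral_gradient_segment _ _ phi)//; last by lra.
  have phi0 s : `|s| = 2^-1 -> phi (0 + s *: t) = 0.
    move=> hs; apply/eqP; apply: contraT => /supp_le.
    by rewrite add0r enormZ t1 mulr1 hs leNgt /rho'; lra.
  by rewrite !phi0 ?subrr ?mulr0// ?normrN ger0_norm.
have gamma0 : \sum_j \int[mu]_(x in Bhalf) (partial j phi x * W j x) = 0.
  by under eq_bigr do rewrite -integral_wrt_gamma; exact: div0.
have ip j (f : V -> R) : mu.-integrable Bhalf (EFin \o f) ->
    mu.-integrable Bhalf (EFin \o (fun x => partial j phi x * f x)).
  by have [M hM] := bound _ (cdphi j); exact: (iM (@cdphi j) hM).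
(* Replacing the gradient of [phi] by [g] plus the basis vector leaves only the component [k] of the
   difference. *)
have wk : \int[mu]_(x in Bhalf) w k x = 0.
  have : \sum_j \int[mu]_(x in Bhalf) (partial j phi x * w j x) = 0.
    under eq_bigr => j _.
      under eq_Rintegral do rewrite mulrBr.
      rewrite RintegralB//; [|exact: ip (iW j)|exact: ip (iL j)].
      over.
    by rewrite sumrB gamma0 line0 subrr.
  have e j : \int[mu]_(x in Bhalf) (partial j phi x * w j x) =
      (k == j)%:R * \int[mu]_(x in Bhalf) w j x.
    have [M hM] := bound _ (cg j).
    under eq_Rintegral => x _.
      rewrite -(subrK (k == j)%:R (partial j phi x)) mulrDl -/(g j x); over.
    rewrite RintegralD//; last first.
    - have := integrableZl mB (k == j)%:R (iw j).
      by apply: eq_integrable => // x _; rewrite /= EFinM.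
    - exact: (iM (@cg j) hM).
    by rewrite gw0 add0r RintegralZl.
  under eq_bigr do rewrite e.
  rewrite (bigD1 k)//= eqxx mul1r big1 ?addr0// => j jk.
  by rewrite eq_sym (negbTE jk) mul0r.
have := RintegralB mB (iW k) (iL k).
rewrite wk => /esym/eqP; rewrite subr_eq0 => /eqP.
have lhs : \int[mu]_(x in gamma) ((theta x 0 i)%:~R * tau x 0 k) =
    \int[mu]_(x in Bhalf) W k x.
  by rewrite -{1}(setIidr GB) Rintegral_mkcondr.
have rhs : (b 0 i)%:~R * t 0 k = \int[mu]_(x in Bhalf) L k x.
  rewrite -Rintegral_mkcondr setIidr; last by move=> x [].
  by rewrite Rintegral_cst// (_ : mu D0 = 1%:E) ?mulr1//; exact: H1_line_Bhalf.
by rewrite -lhs -rhs.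
Qed.

End total_multiplicity.

(** * Lower bound for the energy *)

Section energy_lower_bound.
Context {R : realType} {n : nat}.
Local Notation V := 'rV[R]_n.
Local Notation mu := (H1 R n).

Lemma psi_ge0 (eta : R) b (w : V) : 0 <= eta -> 0 <= psi eta b w.
Proof. by move=> eta0; rewrite addr_ge0 ?sqr_ge0// mulr_ge0 ?sqr_ge0. Qed.

Lemma measurable_psi (eta : R) (Omega gamma : set V) theta tau :
  Mdf Omega gamma theta tau ->
  measurable_fun (gamma : set (H1space R n)) (fun x => psi eta (theta x) (tau x)).
Proof.
move=> [_ _ [_ mtau _] itheta _].
have mth k : measurable_fun (gamma : set (H1space R n))
    (fun x => (theta x 0 k)%:~R : R).
  by apply/measurable_EFinP; case/integrableP: (itheta k).
have -> : (fun x => psi eta (theta x) (tau x)) = (fun x =>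
    \sum_k (theta x 0 k)%:~R * (theta x 0 k)%:~R +
    eta * (\sum_k (theta x 0 k)%:~R * tau x 0 k) ^+ 2).
  apply/funext => x; rewrite psiE /dot; congr (_ + eta * _ ^+ 2).
    by apply: eq_bigr => k _; rewrite !mxE.
  by apply: eq_bigr => k _; rewrite !mxE.
apply: measurable_funD.
  by apply: measurable_sum => k; exact: measurable_funM.
apply: measurable_funM; first exact: measurable_cst.
apply: measurable_funX; apply: measurable_sum => k.
exact: measurable_funM.
Qed.

Lemma energy_ge (eta : R) (i : 'I_n) (beta : int) (t : V) gamma theta tau :
  0 <= eta <= 1 -> enorm t = 1 -> Mdf Bhalf gamma theta tau ->
  straight_near_boundary gamma theta tau (beta *: delta_mx 0 i) t ->
  ((`|beta|%:~R * psi eta (delta_mx 0 i) t)%:E <=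
   \int[mu]_(x in gamma) (psi eta (theta x) (tau x))%:E)%E.
Proof.
move=> eta01 t1 mdf near.
have [_ [mG _ _] [tau1 _ _] _ _] := mdf.
have eta0 : 0 <= eta by case/andP: eta01.
pose s : R := Num.sg beta%:~R.
pose h (x : V) := s * ((theta x 0 i)%:~R * dot (calibration eta i t) (tau x)).
have hE x : h x =
    \sum_k (s * calibration eta i t 0 k) * ((theta x 0 i)%:~R * tau x 0 k).
  by rewrite /h /dot !mulr_sumr; apply: eq_bigr => k _; ring.
have ik k : mu.-integrable gamma (EFin \o (fun x =>
    (s * calibration eta i t 0 k) * ((theta x 0 i)%:~R * tau x 0 k))).
  have := integrableZl mG (s * calibration eta i t 0 k) (integrable_density mdf i k).
  by apply: eq_integrable => // x _; rewrite /= EFinM.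
have ih : mu.-integrable gamma (EFin \o h).
  have := integrable_sumR mG (index_enum _) xpredT ik.
  by apply: eq_integrable => // x _; rewrite /= hE.
have hpsi x : gamma x -> h x <= psi eta (theta x) (tau x).
  move=> gx; apply: calibration_psi => //; first exact: tau1.
  by rewrite normr_sg; case: (_ == _).
have Ih : \int[mu]_(x in gamma) h x = `|beta|%:~R * psi eta (delta_mx 0 i) t.
  under eq_Rintegral do rewrite hE.
  rewrite Rintegral_sum// psi_delta -(calibration_self eta i t1) intr_norm.
  rewrite normrEsg /dot !mulr_sumr; apply: eq_bigr => k _.
  rewrite RintegralZl//; last exact: integrable_density.
  rewrite (total_multiplicity t1 mdf i near) !mxE !eqxx/= mulr1 /s; ring.
(* Infinite energy satisfies the bound trivially; finite energy makes the nonnegative integrand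
   integrable, so that integrals can be compared. *)
have [->|Ioo] := eqVneq (\int[mu]_(x in gamma) (psi eta (theta x) (tau x))%:E)%E +oo%E.
  by rewrite leey.
rewrite -Ih /Rintegral fineK; last exact: integrable_fin_num.
apply: le_integral => //.
- apply/integrableP; split.
    by apply/measurable_EFinP; exact: measurable_psi mdf.
  under eq_integral do rewrite gee0_abs ?lee_fin ?psi_ge0//.
  by rewrite ltey.
- by move=> x /set_mem/hpsi; rewrite lee_fin.
Qed.

End energy_lower_bound.

(** * Measures carried by finitely many segments *)

Section polygonal_measure.
Context {R : realType} {n : nat}.
Local Notation V := 'rV[R]_n.
Local Notation mu := (H1 R n).
Variables (I : finType) (a0 : I).
Variables (p v : I -> V) (len : I -> R) (m : I -> 'rV[int]_n).
Hypothesis v1 : forall a, enorm (v a) = 1.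
Hypothesis len0 : forall a, 0 < len a.

Definition segment_pt a (s : R) : V := p a + s *: v a.
Definition open_segment a : set V := segment_pt a @` `]0, len a[.
Definition closed_segment a : set V := segment_pt a @` `[0, len a].

(** Segments may share endpoints and nothing else. The carrier consists of the open segments, so the
    null set of vertices, where no tangent need exist, is left out. *)
Hypothesis disj : forall a b x,
  open_segment a x -> closed_segment b x -> a = b.

Definition polyline : set V := [set x | exists a, open_segment a x].
(** By [disj] at most one segment passes through a point, so the choice made by [pick] is forced. *)
Definition segment_of (x : V) : option I := [pick a | `[< open_segment a x >]].
Definition polyline_theta (x : V) : 'rV[int]_n := oapp m 0 (segment_of x).
Definition polyline_tau (x : V) : V := oapp v 0 (segment_of x).

Let open_closed a x : open_segment a x -> closed_segment a x.
Proof.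
move=> [s]; rewrite /= in_itv/= => /andP[s0 sl] <-.
by exists s => //; rewrite /= in_itv/= !ltW.
Qed.

Let segment_ofE a x : open_segment a x -> segment_of x = Some a.
Proof.
move=> ax; rewrite /segment_of; case: pickP => [b /asboolP bx|/(_ a)].
  by rewrite (disj ax (open_closed bx)).
by move=> /asboolP.
Qed.

Lemma polyline_thetaE a x : open_segment a x -> polyline_theta x = m a.
Proof. by move=> /segment_ofE; rewrite /polyline_theta => ->. Qed.

Lemma polyline_tauE a x : open_segment a x -> polyline_tau x = v a.
Proof. by move=> /segment_ofE; rewrite /polyline_tau => ->. Qed.

Lemma measurable_segment a : measurable (open_segment a : set (H1space R n)).
Proof. exact: measurable_line_image. Qed.

Lemma H1_segment a : mu (open_segment a) = (len a)%:E.
Proof.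
rewrite /H1/= hausdorff1_line// lebesgue_measure_itv/= lte_fin len0.
by rewrite -EFinB subr0.
Qed.

Let polylineE : polyline = \big[setU/set0]_(a : I) open_segment a.
Proof.
rewrite -bigcup_seq; apply/seteqP; split => x.
  by move=> [a ax]; exists a => //=; rewrite mem_index_enum.
by move=> [a _ ax]; exists a.
Qed.

Lemma measurable_polyline : measurable (polyline : set (H1space R n)).
Proof.
by rewrite polylineE; apply: bigsetU_measurable => a _; exact: measurable_segment.
Qed.

Let patchE (f : V -> R) x : (f \_ polyline) x = \sum_a (f \_ (open_segment a)) x.
Proof.
rewrite {1}/patch; case: ifPn => [/set_mem[a ax]|/negP xG].
  rewrite (bigD1 a)//= /patch mem_set// big1 ?addr0// => b ba.
  rewrite memNset// => bx; case/eqP: ba.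
  by rewrite (disj ax (open_closed bx)).
rewrite big1// => a _; rewrite /patch memNset// => ax.
by apply: xG; apply: mem_set; exists a.
Qed.

Lemma integrable_polyline (f : V -> R) :
  (forall a, mu.-integrable (open_segment a) (EFin \o f)) ->
  mu.-integrable polyline (EFin \o f).
Proof.
move=> fi; apply/(integrable_mkcond _ measurable_polyline).
have fi' a : mu.-integrable setT (EFin \o (f \_ (open_segment a))).
  by rewrite -restrict_EFin; apply/(integrable_mkcond _ (measurable_segment a)).
have := integrable_sumR measurableT (index_enum I) xpredT fi'.
by apply: eq_integrable => // x _; rewrite restrict_EFin /= patchE.
Qed.

Lemma Rintegral_polyline (f : V -> R) :
  (forall a, mu.-integrable (open_segment a) (EFin \o f)) ->
  \int[mu]_(x in polyline) f x = \sum_a \int[mu]_(x in open_segment a) f x.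
Proof.
move=> fi; rewrite Rintegral_mkcond.
under eq_Rintegral do rewrite patchE.
rewrite Rintegral_sum//; first by apply: eq_bigr => a _; rewrite -Rintegral_mkcond.
by move=> a; rewrite -restrict_EFin; apply/(integrable_mkcond _ (measurable_segment a)).
Qed.

Lemma integrable_segment_cst a (c : R) :
  mu.-integrable (open_segment a) (EFin \o (fun=> c)).
Proof.
apply: (@measurable_bounded_integrable _ _ _ mu (cst c) _ (measurable_segment a)).
- by rewrite H1_segment ltry.
- exact: measurable_cst.
- exists `|c|; split; first exact: num_real.
  by move=> y ay x _ /=; rewrite ltW.
Qed.

Lemma integrable_segment_const a (f : V -> R) (c : R) :
  (forall x, open_segment a x -> f x = c) ->
  mu.-integrable (open_segment a) (EFin \o f).
Proof.
move=> fc; have := integrable_segment_cst a c.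
apply: eq_integrable; first exact: measurable_segment.
by move=> x /set_mem/fc; rewrite /= => ->.
Qed.

Lemma rectifiable_polyline : rectifiable1 polyline.
Proof.
split; first exact: measurable_polyline.
- rewrite polylineE.
  apply: (@le_lt_trans _ _ (\sum_(a : I) mu (open_segment a))%E).
    elim/big_ind2 : _ => [|A x B y hA hB|a _]; first by rewrite hausdorff10.
      exact: (le_trans (outer_measureU2 _ _ _) (leeD hA hB)).
    by [].
  by under eq_bigr do rewrite H1_segment; rewrite sumEFin ltry.
(* Indices beyond the enumeration of [I] repeat the line of [a0]. *)
- exists (fun k => segment_pt (nth a0 (enum I) k)); split.
    move=> k; set a := nth _ _ _.
    apply: (@klipschitzW _ _ _ `|v a|).
      exact: (@globally_properfilter _ _ (0, 0)).
    move=> [x y] _ /=; rewrite /segment_pt opprD addrACA subrr add0r.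
    by rewrite -scalerBl normrZ mulrC.
  rewrite (_ : _ `\` _ = set0) ?hausdorff10//.
  rewrite -subset0 => x [[a [s _ <-]]]; apply.
  exists (index a (enum I)) => //; exists s => //.
  by rewrite nth_index// mem_enum.
Qed.

Let hausdorff1_point (x : V) : hausdorff1 [set x] = 0%E.
Proof.
have -> : [set x] = (fun s : R => x + s *: v a0) @` [set 0].
  by rewrite image_set1 scale0r addr0.
by rewrite hausdorff1_line// lebesgue_measure_set1.
Qed.

(** The other closed segments form a finite family of closed sets missing the point, so a small ball
    around it sees only segment [a]. *)
Let locally_line a s : 0 < s < len a -> exists2 rho : R, 0 < rho &
  forall r, 0 < r <= rho -> polyline `&` eball (segment_pt a s) r =
    segment_pt a @` `]s - r, s + r[.
Proof.
move=> /andP[s0 sl].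
have ax : open_segment a (segment_pt a s).
  by exists s => //; rewrite /= in_itv/= s0.
have cclosed b : closed (closed_segment b).
  apply: compact_closed; first exact: norm_hausdorff.
  apply: continuous_compact; last exact: segment_compact.
  exact/continuous_subspaceT/line_continuous.
have : \forall y \near segment_pt a s, forall b, b != a -> ~ closed_segment b y.
  apply: (@filter_forall _ _ (fun b y => b != a -> ~ closed_segment b y)
    (nbhs (segment_pt a s))) => b.
  have [->|ba] := eqVneq b a; first by near=> y.
  have : nbhs (segment_pt a s) (~` closed_segment b).
    apply: open_nbhs_nbhs; split; first exact: closed_openC.
    by move=> bx; case/eqP: ba; rewrite (disj ax bx).
  by apply: filterS => y.
move=> /nbhs_eball[e e0 eP].
exists (Num.min e (Num.min s (len a - s))).
  by rewrite !lt_min e0 s0 subr_gt0.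
move=> r /andP[r0]; rewrite !le_min => /andP[re /andP[rs rl]].
have dist u : enorm (segment_pt a u - segment_pt a s) = `|u - s|.
  by rewrite /segment_pt opprD addrACA subrr add0r -scalerBl enormZ v1 mulr1.
apply/seteqP; split => [y [[b by_] yr]|_ [u /= ur <-]].
  have ba : b = a.
    apply/eqP; apply: contraT => ba.
    exfalso; apply: (eP y _ b ba (open_closed by_)).
    by rewrite /eball /= (lt_le_trans yr).
  move: by_; rewrite ba => -[u ul uy]; exists u => //=.
  move: yr; rewrite -uy /eball /= dist ltr_norml in_itv/= => /andP[? ?].
  by apply/andP; split; lra.
rewrite in_itv/= in ur; split.
  exists a; exists u => //=; rewrite in_itv/=.
  by case/andP : ur => ? ?; apply/andP; split; lra.
rewrite /eball /= dist ltr_norml.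
by case/andP : ur => ? ?; apply/andP; split; lra.
Unshelve. all: by end_near. Qed.

Lemma approx_tangent_polyline a x : open_segment a x ->
  approx_tangent polyline x (v a).
Proof.
move=> [s]; rewrite /= in_itv/= => s01 <-.
have [rho rho0 rhoP] := locally_line s01.
split => //.
(* A small ball of radius [r] cuts out length [2 * r], so the upper density is at least 2. *)
- apply: (@lt_le_trans _ _ 2%:E); first by rewrite lte_fin.
  apply: le_ereal_inf_tmp => _ [A A0 <-].
  have : \forall r \near 0^'+, [/\ A r, 0 < r & r <= rho].
    near=> r; split; last 2 first.
    + by near: r; exact: nbhs_right_gt.
    + by near: r; exact: nbhs_right_le.
    by near: r.
  move=> /filter_ex[r [Ar r0 rrho]].
  apply: ereal_sup_ubound; exists r => //.
  rewrite rhoP ?r0// hausdorff1_line// lebesgue_measure_itv/= lte_fin ifT; last by lra.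
  rewrite -EFinD -EFinM; congr EFin.
  field.
  by rewrite gt_eqF.
- move=> e e0; apply: cvg_near_cst.
  near=> r.
  (* A point of the line has no component orthogonal to it, so the only one outside the open cone is
     the vertex. *)
  rewrite (_ : hausdorff1 _ = 0%E) ?mule0//.
  apply/eqP; rewrite eq_le hausdorff1_ge0 andbT.
  rewrite -(hausdorff1_point (segment_pt a s)); apply: le_hausdorff1.
  rewrite rhoP; last first.
    apply/andP; split; near: r; first exact: nbhs_right_gt.
    exact: nbhs_right_le.
  move=> _ [[u _ <-]]; rewrite /off_cone /= /segment_pt opprD addrACA subrr add0r.
  rewrite -scalerBl dotZl dot_unit// mulr1 subrr enorm0 enormZ v1 mulr1.
  rewrite pmulr_rle0// normr_le0 subr_eq0 => /eqP ->.
  by [].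
Unshelve. all: by end_near. Qed.

Lemma unit_tangent_polyline : unit_tangent polyline polyline_tau.
Proof.
split.
- by move=> x [a ax]; rewrite (polyline_tauE ax).
- move=> j; apply/measurable_EFinP.
  suff /integrableP[] : mu.-integrable polyline
    (EFin \o (fun x => polyline_tau x 0 j)) by [].
  apply: integrable_polyline => a.
  apply: (@integrable_segment_const _ _ (v a 0 j)).
  by move=> x ax; rewrite (polyline_tauE ax).
- apply: aeW => x [a ax]; rewrite (polyline_tauE ax).
  exact: approx_tangent_polyline.
Qed.

Lemma integrable_polyline_theta : integrable_multiplicity polyline polyline_theta.
Proof.
move=> i; apply: integrable_polyline => a.
apply: (@integrable_segment_const _ _ (m a 0 i)%:~R).
by move=> x ax; rewrite (polyline_thetaE ax).
Qed.

Let smooth_gradient (phi : V -> R) : smooth phi ->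
  [/\ continuous phi, forall j x, derivable phi x (delta_mx 0 j) &
      forall j, continuous (partial j phi)].
Proof.
move=> sphi; have [c d] := sphi [::]; split=> // j.
by have [] := sphi [:: j].
Qed.

(** Each segment contributes its multiplicity times the increment of [phi] between its ends. The
    hypothesis is Kirchhoff's law in tested form, so vertices outside [Omega], where [phi] vanishes,
    need no balance. *)
Lemma divergence_free_polyline (Omega : set V) :
  (forall phi, test_function Omega phi -> forall i,
    \sum_a (m a 0 i)%:~R *
      (phi (segment_pt a (len a)) - phi (segment_pt a 0)) = 0) ->
  divergence_free Omega polyline polyline_theta polyline_tau.
Proof.
move=> kirchhoff phi tphi i; rewrite -[RHS](kirchhoff phi tphi i).
have [sphi _ _] := tphi; have [cphi dphi cdphi] := smooth_gradient sphi.
have ip a j : mu.-integrable (open_segment a) (EFin \o partial j phi).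
  apply: (@integrable_line _ _ (p a) (v a) _ `]0, len a[ 0) => //.
    by rewrite /= in_itv/= ltxx.
  have cg : continuous (fun s : R => partial j phi (p a + s *: v a)).
    exact: comp_line_continuous.
  have gi : lebesgue_measure.-integrable `[0, len a]
      (EFin \o (fun s : R => partial j phi (p a + s *: v a))).
    apply: continuous_compact_integrable; first exact: segment_compact.
    exact: continuous_subspaceT.
  have : lebesgue_measure.-integrable `]0, len a[
      (EFin \o (fun s : R => partial j phi (p a + s *: v a))).
    by apply: integrableS gi => //; exact: subset_itv_oo_cc.
  exact.
have ipm a j (c : R) : mu.-integrable (open_segment a)
    (EFin \o (fun x => c * partial j phi x)).
  have := integrableZl (measurable_segment a) c (ip a j).
  apply: eq_integrable; first exact: measurable_segment.
  by move=> x _; rewrite /= EFinM.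
have iF a j : mu.-integrable (open_segment a) (EFin \o (fun x =>
    partial j phi x * ((polyline_theta x 0 i)%:~R * polyline_tau x 0 j))).
  have := ipm a j ((m a 0 i)%:~R * v a 0 j).
  apply: eq_integrable; first exact: measurable_segment.
  by move=> x /set_mem ax; rewrite /= (polyline_thetaE ax) (polyline_tauE ax) mulrC.
rewrite /integral_wrt.
under eq_bigr do rewrite Rintegral_polyline//.
rewrite exchange_big; apply: eq_bigr => a _ /=.
have -> : phi (segment_pt a (len a)) - phi (segment_pt a 0) =
    \int[mu]_(x in open_segment a) \sum_j v a 0 j * partial j phi x.
  by rewrite /Rintegral (@integral_gradient_segment _ _ phi).
rewrite Rintegral_sum; last by [].
  rewrite mulr_sumr; apply: eq_bigr => j _.
  rewrite -RintegralZl//.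
    apply: eq_Rintegral => x /set_mem ax.
    by rewrite (polyline_thetaE ax) (polyline_tauE ax); ring.
  exact: measurable_segment.
exact: measurable_segment.
Qed.

Lemma Mdf_polyline (Omega : set V) : polyline `<=` Omega ->
  (forall phi, test_function Omega phi -> forall i,
    \sum_a (m a 0 i)%:~R *
      (phi (segment_pt a (len a)) - phi (segment_pt a 0)) = 0) ->
  Mdf Omega polyline polyline_theta polyline_tau.
Proof.
move=> GO kirchhoff; split.
- exact: GO.
- exact: rectifiable_polyline.
- exact: unit_tangent_polyline.
- exact: integrable_polyline_theta.
- exact: divergence_free_polyline.
Qed.

Lemma energy_polyline (eta : R) :
  (\int[mu]_(x in polyline) (psi eta (polyline_theta x) (polyline_tau x))%:E)%E =
  (\sum_a psi eta (m a) (v a) * len a)%:E.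
Proof.
pose f x := psi eta (polyline_theta x) (polyline_tau x).
have fE a x : open_segment a x -> f x = psi eta (m a) (v a).
  by move=> ax; rewrite /f (polyline_thetaE ax) (polyline_tauE ax).
have fi a : mu.-integrable (open_segment a) (EFin \o f).
  exact: integrable_segment_const (fE a).
rewrite -[LHS]fineK; last first.
  by apply: integrable_fin_num; [exact: measurable_polyline|exact: integrable_polyline].
congr EFin; transitivity (\int[mu]_(x in polyline) f x); first by [].
rewrite Rintegral_polyline//.
apply: eq_bigr => a _.
transitivity (\int[mu]_(x in open_segment a) psi eta (m a) (v a)).
  by apply: eq_Rintegral => x /set_mem/fE.
rewrite Rintegral_cst; last exact: measurable_segment.
by rewrite H1_segment.
Qed.

End polygonal_measure.

(** * The split competitor and the upper bound *)

Lemma exists_unit_orthogonal (R : realType) (n : nat) (t : 'rV[R]_n) :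
  (2 <= n)%N -> exists2 u : 'rV[R]_n, enorm u = 1 & dot t u = 0.
Proof.
move=> n2.
suff [w w0 tw] : exists2 w : 'rV[R]_n, w != 0 & dot t w = 0.
  have nw : enorm w != 0 by apply: contra_neq w0; exact: enorm_eq0.
  exists ((enorm w)^-1 *: w); last by rewrite dotZr tw mulr0.
  by rewrite enormZ normfV ger0_norm ?enorm_ge0// mulVf.
pose k0 := Ordinal (ltnW n2); pose k1 := Ordinal n2.
have k10 : (k1 == k0) = false by [].
have [t0|t0] := eqVneq (t 0 k0) 0.
  exists (delta_mx 0 k0); last by rewrite dot_delta.
  by apply/eqP => /rowP/(_ k0)/eqP; rewrite !mxE !eqxx oner_eq0.
exists (t 0 k1 *: delta_mx 0 k0 - t 0 k0 *: delta_mx 0 k1).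
  apply/eqP => /rowP/(_ k1)/eqP; rewrite !mxE !eqxx k10/= mulr0 mulr1 sub0r.
  by rewrite oppr_eq0 (negbTE t0).
by rewrite dotBr !dotZr !dot_delta mulrC subrr.
Qed.

Section competitor.
Context {R : realType} {n : nat}.
Local Notation V := 'rV[R]_n.
Variables (t u : V) (d : R) (i : 'I_n) (beta : int).
Hypothesis t1 : enorm t = 1.
Hypothesis u1 : enorm u = 1.
Hypothesis tu : dot t u = 0.
Hypothesis d0 : 0 < d.
Hypothesis d4 : d <= 4^-1.

Let N := `|beta|%N.
Let r : R := 2^-1 - d.
(** Dividing by [N.+1] keeps all heights distinct and at most [d], and stays meaningful for
    [beta = 0], when there are no paths. *)
Let height (k : 'I_N) : R := d * (k%:R / N.+1%:R).

Let betaE : beta%:~R = (sgz beta)%:~R * N%:R :> R.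
Proof. by rewrite {1}(intEsg beta) intrM. Qed.

Let height_ge0 k : 0 <= height k.
Proof. by rewrite mulr_ge0 ?(ltW d0)// divr_ge0. Qed.

Let height_le k : height k <= d.
Proof.
rewrite ler_piMr ?(ltW d0)// ler_pdivrMr ?ltr0n// mul1r ler_nat.
by rewrite ltnW// ltnS ltnW.
Qed.

Let height_inj : injective height.
Proof.
have d_neq0 : d != 0 by rewrite gt_eqF.
have N_neq0 : N.+1%:R != 0 :> R by rewrite pnatr_eq0.
move=> k l /(mulfI d_neq0)/(mulIf (invr_neq0 N_neq0))/eqP.
by rewrite eqr_nat => /eqP/val_inj.
Qed.

Let r_bounds : 4^-1 <= r < 2^-1.
Proof.
by have h0 := d0; have h4 := d4; rewrite /r; apply/andP; split; lra.
Qed.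

(* Points are given by their coordinates along t and u. inl: the two straight
   pieces near the boundary, with full multiplicity; inr: the rising and the
   falling half of the k-th path, with multiplicity sgz beta. *)
Let I : finType := (bool + bool * 'I_N)%type.

Let start (a : I) : R * R := match a with
  | inl false => (- 2^-1, 0)
  | inl true => (r, 0)
  | inr (false, k) => (- r, 0)
  | inr (true, k) => (0, height k)
  end.

Let stop (a : I) : R * R := match a with
  | inl false => (- r, 0)
  | inl true => (2^-1, 0)
  | inr (false, k) => (0, height k)
  | inr (true, k) => (r, 0)
  end.

Let at_ (c : R * R) : V := c.1 *: t + c.2 *: u.
Let vec (a : I) : V := at_ (stop a) - at_ (start a).
Let len (a : I) : R := enorm (vec a).
Let dir (a : I) : V := (len a)^-1 *: vec a.
Let mult (a : I) : 'rV[int]_n :=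
  (if a is inl _ then beta else sgz beta) *: delta_mx 0 i.

Let dot_at1 c : dot (at_ c) t = c.1.
Proof.
by rewrite /at_ dotDl !dotZl dot_unit// (dotC u) tu mulr0 mulr1 addr0.
Qed.

Let dot_at2 c : dot (at_ c) u = c.2.
Proof. by rewrite /at_ dotDl !dotZl tu (dot_unit u1) mulr0 mulr1 add0r. Qed.

Let dot_at c : dot (at_ c) (at_ c) = c.1 ^+ 2 + c.2 ^+ 2.
Proof. by rewrite {2}/at_ dotDr !dotZr dot_at1 dot_at2 !expr2. Qed.

Let at_lin (c c' : R * R) (l : R) :
  at_ c + l *: (at_ c' - at_ c) =
  at_ (c.1 + l * (c'.1 - c.1), c.2 + l * (c'.2 - c.2)).
Proof.
rewrite /at_ /=; apply/rowP => j; rewrite !mxE; ring.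
Qed.

Let vecE a : vec a = at_ ((stop a).1 - (start a).1, (stop a).2 - (start a).2).
Proof. by rewrite /vec /at_ /=; apply/rowP => j; rewrite !mxE; ring. Qed.

Let len_gt0 a : 0 < len a.
Proof.
rewrite lt_def enorm_ge0 andbT; apply/eqP => /(congr1 (fun x => x ^+ 2)).
rewrite /len sqr_enorm vecE dot_at /= expr0n /=.
have /andP[r4 r2] := r_bounds.
case: a => [[]|[[] k]] /=; apply/eqP; rewrite gt_eqF//.
- by rewrite ltr_wpDr ?sqr_ge0// exprn_gt0//; lra.
- by rewrite ltr_wpDr ?sqr_ge0// exprn_gt0//; lra.
- by rewrite ltr_wpDr ?sqr_ge0// exprn_gt0//; lra.
- by rewrite ltr_wpDr ?sqr_ge0// exprn_gt0//; lra.
Qed.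

Let dir1 a : enorm (dir a) = 1.
Proof.
rewrite /dir enormZ ger0_norm ?invr_ge0 ?(ltW (len_gt0 a))//.
by rewrite mulVf// gt_eqF.
Qed.

Let segE a (s : R) : segment_pt (at_ \o start) dir a s =
  at_ ((start a).1 + s / len a * ((stop a).1 - (start a).1),
       (start a).2 + s / len a * ((stop a).2 - (start a).2)).
Proof. by rewrite /segment_pt /= /dir scalerA at_lin. Qed.

Let start_lt_stop a : (start a).1 < (stop a).1.
Proof.
have /andP[r4 r2] := r_bounds.
by case: a => [[]|[[] k]] /=; lra.
Qed.

Let lin_oo (x y l : R) : x < y -> 0 < l < 1 -> x < x + l * (y - x) < y.
Proof. by move=> xy /andP[l0 l1]; apply/andP; split; nra. Qed.

Let lin_cc (x y l : R) : x < y -> 0 <= l <= 1 -> x <= x + l * (y - x) <= y.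
Proof. by move=> xy /andP[l0 l1]; apply/andP; split; nra. Qed.

Let lin_inj (x y l l' : R) : x < y ->
  x + l * (y - x) = x + l' * (y - x) -> l = l'.
Proof.
move=> xy /addrI/mulIf; apply; by rewrite subr_eq0 gt_eqF.
Qed.

Let open_segmentP a x : open_segment (at_ \o start) dir len a x <->
  exists2 l : R, 0 < l < 1 &
  x = at_ ((start a).1 + l * ((stop a).1 - (start a).1),
           (start a).2 + l * ((stop a).2 - (start a).2)).
Proof.
have la := len_gt0 a; split=> [[s] /=|[l l01 ->]].
  rewrite in_itv/= => /andP[s0 sl] <-; exists (s / len a); last exact: segE.
  by rewrite divr_gt0//= ltr_pdivrMr// mul1r.
exists (l * len a); last by rewrite segE mulfK// gt_eqF.
by rewrite /= in_itv/= mulr_gt0 ?(andP l01).1//= gtr_pMl// (andP l01).2.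
Qed.

Let disj a b x : open_segment (at_ \o start) dir len a x ->
  closed_segment (at_ \o start) dir len b x -> a = b.
Proof.
move=> /open_segmentP[l l01 ->] [s /=]; rewrite in_itv/= => /andP[s0 sl].
rewrite segE; have l01' : 0 <= s / len b <= 1.
  by rewrite divr_ge0 ?(ltW (len_gt0 b))//= ler_pdivrMr// mul1r.
move: (s / len b) l01' => l' l01' {s s0 sl} E.
have := congr1 (fun x => dot x u) E; have := congr1 (fun x => dot x t) E.
rewrite !dot_at1 !dot_at2 /= => {E} Ex Ey.
have Xa := lin_oo (start_lt_stop a) l01.
have := lin_cc (start_lt_stop b) l01'; rewrite Ex => Xb.
(* The coordinate along [t] already tells the left piece, the rising halves, the falling halves and
   the right piece apart. Two segments over the same interval meet at equal parameters, and then
   their heights must coincide. *)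
have same : (start a).1 = (start b).1 -> (stop a).1 = (stop b).1 -> l = l'.
  by move=> ea eb; apply: (lin_inj (start_lt_stop a)); rewrite -Ex ea eb.
have /andP[r4 r2] := r_bounds.
have {}l01 : l != 0 /\ 1 - l != 0.
  by case/andP: l01 => ? ?; rewrite subr_eq0 gt_eqF// gt_eqF.
move: Xa Xb same Ey; clear Ex; move: (_ + _) => y.
case: a => [[]|[[] k]]; case: b => [[]|[[] k']] //= /andP[a1 a2] /andP[b1 b2] same Ey;
  try (exfalso; lra).
- have {same} ll := same erefl erefl; rewrite -ll in Ey.
  have /(mulfI l01.2)/height_inj -> // : (1 - l) * height k = (1 - l) * height k'.
  by lra.
- have {same} ll := same erefl erefl; move: Ey; rewrite -ll !subr0 !add0r.
  by move=> /(mulfI l01.1)/height_inj ->.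
Qed.

Let norm_at c : enorm (at_ c) <= `|c.1| + `|c.2|.
Proof.
rewrite /at_ (le_trans (ler_enormD _ _))// !enormZ t1 u1 !mulr1//.
Qed.

(** All vertices of the paths lie in the closed ball of radius [r], which is convex; for the peaks
    this uses [d <= r], a consequence of [d <= 4^-1]. *)
Let inner_le a x : ~~ (if a is inl _ then true else false) ->
  open_segment (at_ \o start) dir len a x -> enorm x <= r.
Proof.
have /andP[r4 r2] := r_bounds.
move=> ia /open_segmentP[l /andP[l0 l1] ->].
rewrite -at_lin.
have -> : at_ (start a) + l *: (at_ (stop a) - at_ (start a)) =
    (1 - l) *: at_ (start a) + l *: at_ (stop a).
  by apply/rowP => j; rewrite !mxE; ring.
rewrite (le_trans (ler_enormD _ _))// !enormZ.
rewrite (gtr0_norm l0) gtr0_norm ?subr_gt0//.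
have d4' := d4; have dr : d <= r by rewrite /r; lra.
have er x' : `|x'| = r -> enorm (at_ (x', 0)) <= r.
  by move=> xr; rewrite (le_trans (norm_at _))//= xr normr0 addr0.
have eh k : enorm (at_ (0, height k)) <= r.
  rewrite (le_trans (norm_at _))//= normr0 add0r ger0_norm ?height_ge0//.
  exact: le_trans (height_le k) dr.
have r0 : 0 <= r by lra.
have [es et] : enorm (at_ (start a)) <= r /\ enorm (at_ (stop a)) <= r.
  case: a ia => [[]|[[] k]] //= _; split; rewrite ?eh ?er// ?normrN ger0_norm//.
have := ler_wpM2l (ltW l0) et.
have l1' : 0 <= 1 - l by rewrite subr_ge0 ltW.
have := ler_wpM2l l1' es; lra.
Qed.

Let outer_sub a x : (if a is inl _ then true else false) ->
  open_segment (at_ \o start) dir len a x -> (line t `&` Bhalf) x.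
Proof.
have /andP[r4 r2] := r_bounds.
move=> oa /open_segmentP[l l01 ->].
have := lin_oo (start_lt_stop a) l01; case: a oa => // b _ /= lb.
rewrite (_ : (if b then (r, 0) else (- 2^-1, 0)).2 +
  l * ((if b then (2^-1, 0) else (- r, 0)).2 -
       (if b then (r, 0) else (- 2^-1, 0)).2) = 0); last first.
  by case: b {lb} => /=; rewrite subrr mulr0 addr0.
move: lb; move: (_ + _) => y lb.
have ym : `|y| < 2^-1.
  by rewrite ltr_norml; case: b lb => /= /andP[? ?]; apply/andP; split; lra.
split; first by exists y => //; rewrite /at_ /= scale0r addr0.
by rewrite /Bhalf /eball /= subr0 /at_ /= scale0r addr0 enormZ t1 mulr1.
Qed.

Let outer_cover x : (line t `&` Bhalf) x -> r < enorm x ->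
  exists b : bool, open_segment (at_ \o start) dir len (inl b) x.
Proof.
have dgt0 := d0.
move=> [[s _ <-]]; rewrite /Bhalf /eball /= subr0 enormZ t1 mulr1 => s2 rs.
have cover (b : bool) (l : R) : 0 < l < 1 ->
    s = (start (inl b)).1 + l * ((stop (inl b)).1 - (start (inl b)).1) ->
    exists b : bool, open_segment (at_ \o start) dir len (inl b) (s *: t).
  move=> l01 sE; exists b; apply/open_segmentP; exists l => //.
  by rewrite /at_ -sE; case: b {sE} => /=; rewrite subrr mulr0 addr0 scale0r addr0.
have [s0|s0] := leP 0 s.
  rewrite ger0_norm// in s2 rs.
  apply: (cover true ((s - r) / d)) => /=; last first.
    by rewrite /r; field; rewrite gt_eqF.
  rewrite divr_gt0 ?subr_gt0//= ltr_pdivrMr// mul1r /r; lra.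
rewrite ltr0_norm// in s2 rs.
apply: (cover false ((s + 2^-1) / d)) => /=; last first.
  by rewrite /r; field; rewrite gt_eqF.
apply/andP; split; first by rewrite divr_gt0//; lra.
by rewrite ltr_pdivrMr// mul1r; move: rs; rewrite /r; lra.
Qed.

Let len_outer b : len (inl b) = d.
Proof.
rewrite /len vecE /at_; have -> : (stop (inl b)).1 - (start (inl b)).1 = d.
  by case: b => /=; rewrite /r; lra.
have -> : (stop (inl b)).2 - (start (inl b)).2 = 0 by case: b => /=; rewrite subrr.
by rewrite scale0r addr0 enormZ t1 mulr1 ger0_norm// ltW.
Qed.

Let dir_outer b : dir (inl b) = t.
Proof.
rewrite /dir len_outer vecE /at_.
have -> : (stop (inl b)).1 - (start (inl b)).1 = d by case: b => /=; rewrite /r; lra.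
have -> : (stop (inl b)).2 - (start (inl b)).2 = 0 by case: b => /=; rewrite subrr.
by rewrite scale0r addr0 scalerA mulVf ?scale1r// gt_eqF.
Qed.

Let sum_I (F : I -> R) : \sum_a F a = F (inl false) + F (inl true) +
  \sum_(k < N) (F (inr (false, k)) + F (inr (true, k))).
Proof.
rewrite big_sumType big_bool /= [F (inl true) + _]addrC; congr (_ + _).
rewrite (eq_bigr (fun q => F (inr (q.1, q.2)))); last by case.
rewrite -(pair_bigA _ (fun b k => F (inr (b, k)))) big_bool/= addrC.
by rewrite -big_split.
Qed.

Definition competitor : set V := polyline (at_ \o start) dir len.
Definition competitor_theta := polyline_theta (at_ \o start) dir len mult.
Definition competitor_tau := polyline_tau (at_ \o start) dir len.

Lemma competitor_Mdf : Mdf Bhalf competitor competitor_theta competitor_tau.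
Proof.
have /andP[r4 r2] := r_bounds.
apply: (Mdf_polyline (inl true) dir1 len_gt0 disj).
  move=> x [a ax]; have [oa|oa] := boolP (if a is inl _ then true else false).
    by have [] := outer_sub oa ax.
  by rewrite /Bhalf /eball /= subr0 (le_lt_trans (inner_le oa ax)).
move=> phi [_ _ supp] j.
(* The two outer ends lie on the sphere, hence outside the support of [phi]. *)
have phi0 s : `|s| = 2^-1 -> phi (at_ (s, 0)) = 0.
  move=> hs; apply/eqP; apply: contraT => px.
  have : Bhalf (at_ (s, 0)) by apply: supp; exact: subset_closure.
  rewrite /Bhalf /eball /= subr0 /at_ /= scale0r addr0 enormZ t1 mulr1 hs.
  by rewrite ltxx.
have ends a : phi (segment_pt (at_ \o start) dir a (len a)) -
    phi (segment_pt (at_ \o start) dir a 0) = phi (at_ (stop a)) - phi (at_ (start a)).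
  have la : len a != 0 by rewrite gt_eqF.
  rewrite /segment_pt /= /dir scale0r addr0 scalerA mulfV// scale1r.
  by rewrite /vec addrCA subrr addr0.
under eq_bigr do rewrite ends.
rewrite sum_I /= (phi0 (- 2^-1)) ?normrN ?ger0_norm// (phi0 2^-1) ?ger0_norm//.
rewrite subr0 sub0r.
set A := phi (at_ (- r, 0)); set B := phi (at_ (r, 0)).
pose kappa : R := ((delta_mx 0 i : 'rV[int]_n) 0 j)%:~R.
have multE a : (mult a 0 j)%:~R =
    (if a is inl _ then beta else sgz beta)%:~R * kappa :> R.
  rewrite -intrM; congr (_%:~R).
  by rewrite /mult [LHS]mxE.
(* The peak of each path cancels; the remaining contribution is the same for all paths, and the [N]
   of them together balance the outer pieces. *)
rewrite (eq_bigr (fun=> (sgz beta)%:~R * kappa * (B - A))); last first.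
  by move=> k _; rewrite !multE; ring.
rewrite sumr_const card_ord !multE -mulr_natl {1 2}betaE; ring.
Qed.

Lemma competitor_near_boundary :
  straight_near_boundary competitor competitor_theta competitor_tau
    (beta *: delta_mx 0 i) t.
Proof.
have /andP[r4 r2] := r_bounds.
(* Strictly larger than [r], so that beyond it only the outer pieces are present, without their
   inner ends; there the two densities agree pointwise. *)
pose r' := (r + 2^-1) / 2.
have rr' : r < r' by rewrite /r'; lra.
have r'2 : r' < 2^-1 by rewrite /r'; lra.
have cl : closure (eball (0 : V) r') `<=` [set x | enorm (x - 0) <= r'].
  rewrite [X in _ `<=` X](closure_id _).1; last exact: closed_eball.
  by apply: closure_subset => x; exact: ltW.
exists 0, r'; split.
- by lra.
- apply: subclosed_compact (@compact_eball R n 0 r') cl.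
  exact: closed_closure.
- by move=> x /cl /= h; rewrite /Bhalf /eball /= (le_lt_trans h).
move=> E _ EB; apply/matrixP => k j; rewrite !mxE /integral_wrt.
rewrite Rintegral_mkcond [RHS]Rintegral_mkcond; apply: eq_Rintegral => x _.
have [Ex|Ex] := pselect (E x); last first.
  have E0 : \1_E x = 0 :> R by rewrite indicE memNset.
  by rewrite /patch E0 !mul0r; do 2 case: ifP.
have xr : r < enorm x.
  rewrite (lt_le_trans rr')// leNgt; apply/negP => xr; have [_] := EB x Ex.
  by apply; rewrite /eball /= subr0.
have [xL|xL] := pselect ((line t `&` Bhalf) x).
  have [b xb] := outer_cover xL xr.
  rewrite /patch mem_set; last by exists (inl b).
  rewrite mem_set//.
  rewrite /competitor_theta /competitor_tau (polyline_thetaE mult disj xb).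
  by rewrite (polyline_tauE disj xb) dir_outer.
rewrite /patch memNset ?memNset// => -[a xa].
have [oa|oa] := boolP (if a is inl _ then true else false).
  by apply: xL; exact: outer_sub xa.
by have := inner_le oa xa; rewrite leNgt xr.
Qed.

(** Both halves have the same length [q] and directions [(r t + h u) / q] and [(r t - h u) / q], so
    the mixed terms cancel in the sum. The rest is controlled by [r <= q <= r + h], [h <= d] and
    [2 * r <= 1]. *)
Let path_energy (eta : R) k : 0 <= eta <= 1 ->
  (1 + eta * dir (inr (false, k)) 0 i ^+ 2) * len (inr (false, k)) +
  (1 + eta * dir (inr (true, k)) 0 i ^+ 2) * len (inr (true, k)) <=
  1 + eta * t 0 i ^+ 2 + 4 * d.
Proof.
move=> /andP[eta0 eta1]; have /andP[r4 r2] := r_bounds.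
have h0 := height_ge0 k; have hd := height_le k; have d4' := d4; have dgt0 := d0.
set h := height k in h0 hd *; pose q := Num.sqrt (r ^+ 2 + h ^+ 2).
have lenE b : len (inr (b, k)) = q.
  by rewrite /len vecE /enorm dot_at; case: b; congr Num.sqrt => /=; rewrite -/h; ring.
have q2 : q ^+ 2 = r ^+ 2 + h ^+ 2 by rewrite sqr_sqrtr// addr_ge0 ?sqr_ge0.
have q0 : 0 <= q by exact: sqrtr_ge0.
have qr : r <= q by rewrite -(ler_pXn2r (ltn0Sn 1)) ?nnegrE//; [nra|lra].
have qrh : q <= r + h by rewrite -(ler_pXn2r (ltn0Sn 1)) ?nnegrE//; [nra|lra].
have qgt0 : 0 < q by lra.
have dirE b : dir (inr (b, k)) 0 i =
    q^-1 * (r * t 0 i + (if b then - h else h) * u 0 i).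
  by rewrite /dir lenE vecE /at_ !mxE; case: b => /=; rewrite -/h; congr (_ * _); ring.
have ti : t 0 i ^+ 2 <= 1 by rewrite -(dot_unit t1) sqr_coord_le_dot.
have ui : u 0 i ^+ 2 <= 1 by rewrite -(dot_unit u1) sqr_coord_le_dot.
rewrite !lenE !dirE.
set X := r ^+ 2 * t 0 i ^+ 2 + h ^+ 2 * u 0 i ^+ 2.
rewrite (_ : _ + _ = 2 * q + 2 * eta * (X / q)); last first.
  by rewrite /X; field; rewrite gt_eqF.
have Xq : X / q <= r * t 0 i ^+ 2 + h.
  rewrite ler_pdivrMr//.
  have : 0 <= (r * t 0 i ^+ 2 + h) * (q - r).
    by rewrite mulr_ge0 ?subr_ge0// addr_ge0// mulr_ge0 ?sqr_ge0//; lra.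
  have : h ^+ 2 * u 0 i ^+ 2 <= h * r.
    rewrite (le_trans (ler_piMr (sqr_ge0 h) ui))// expr2 ler_wpM2l//.
    by move: hd; rewrite /r; lra.
  by rewrite /X; lra.
have tr : r * t 0 i ^+ 2 <= 2^-1 * t 0 i ^+ 2 by rewrite ler_wpM2r ?sqr_ge0// ltW.
have := ler_wpM2l eta0 Xq; have := ler_wpM2l eta0 tr.
have : eta * h <= h by rewrite ler_piMl.
lra.
Qed.

(** The two outer pieces cost [2 * N ^+ 2 * d] times a factor [1 + eta * t 0 i ^+ 2] that is at most
    2; each of the [N] paths exceeds the ideal value by at most [4 * d]. *)
Lemma competitor_energy (eta : R) : 0 <= eta <= 1 ->
  (\int[H1 R n]_(x in competitor)
     (psi eta (competitor_theta x) (competitor_tau x))%:E <=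
   (N%:R * psi eta (delta_mx 0 i) t + (4 * N%:R ^+ 2 + 4 * N%:R) * d)%:E)%E.
Proof.
move=> eta01; have /andP[eta0 eta1] := eta01.
rewrite (energy_polyline _ dir1 len_gt0 disj).
rewrite lee_fin sum_I /= !dir_outer !len_outer psi_delta.
rewrite /mult !psi_scale_delta.
set c := 1 + eta * t 0 i ^+ 2.
have c2 : c <= 2.
  by rewrite -[2]/(1 + 1) lerD2l mulr_ile1 ?sqr_ge0// -(dot_unit t1) sqr_coord_le_dot.
have sg1 : 0 <= ((sgz beta)%:~R : R) ^+ 2 <= 1.
  rewrite sqr_ge0/=; case: sgzP => _.
  - by rewrite mulr0z expr0n.
  - by rewrite mulr1z expr1n.
  - by rewrite mulrN1z sqrrN expr1n.
have beta2 : beta%:~R ^+ 2 = N%:R ^+ 2 :> R.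
  by rewrite -[LHS]real_normK ?num_real// -intr_norm -abszE.
rewrite beta2.
have sumle : \sum_(k < N) ((sgz beta)%:~R ^+ 2 *
     (1 + eta * dir (inr (false, k)) 0 i ^+ 2) * len (inr (false, k)) +
     (sgz beta)%:~R ^+ 2 *
     (1 + eta * dir (inr (true, k)) 0 i ^+ 2) * len (inr (true, k))) <=
     \sum_(k < N) (c + 4 * d).
  apply: ler_sum => k _; rewrite -(mulrA (_ ^+ 2)) -[X in _ + X <= _]mulrA -mulrDr.
  apply: le_trans (path_energy k eta01).
  case/andP: sg1 => _ sg1; rewrite ler_piMl// addr_ge0// mulr_ge0 ?(ltW (len_gt0 _))//.
    by rewrite addr_ge0// mulr_ge0 ?sqr_ge0.
  by rewrite addr_ge0// mulr_ge0 ?sqr_ge0.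
rewrite sumr_const card_ord -[_ *+ N]mulr_natl in sumle.
have N2 : 0 <= N%:R ^+ 2 * d * (2 - c).
  by rewrite mulr_ge0 ?subr_ge0// mulr_ge0 ?sqr_ge0// ltW.
under eq_bigr do rewrite !psi_scale_delta.
apply: (le_trans (lerD (lexx _) sumle)).
by move: N2; lra.
Qed.

End competitor.

Theorem lemma4p4 (R : realType) (n : nat) (eta : R) :
  0 <= eta <= 1 -> (2 <= n <= 9)%N ->
  forall (i : 'I_n) (beta : int) (t : 'rV[R]_n), enorm t = 1 ->
    H1_elliptic_envelope (psi eta) (beta *: delta_mx 0 i) t =
      (`|beta|%:~R * psi eta (delta_mx 0 i) t)%:E.
Proof.
move=> eta01 /andP[n2 _] i beta t t1; apply/eqP; rewrite eq_le; apply/andP; split.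
  apply/lee_addgt0Pr => e e0.
  have [u u1 tu] := exists_unit_orthogonal t n2.
  pose N : R := `|beta|%N%:R.
  pose C : R := 4 * N ^+ 2 + 4 * N.
  have N0 : 0 <= N by rewrite ler0n.
  have C0 : 0 <= C by rewrite addr_ge0// mulr_ge0// sqr_ge0.
  (* This makes the excess [C * d] at most [e]; adding 1 avoids a division by zero when
     [beta = 0]. *)
  pose d := Num.min 4^-1 (e / (C + 1)).
  have C1 : 0 < C + 1 by rewrite ltr_wpDl.
  have d0 : 0 < d by rewrite lt_min divr_gt0// andbT invr_gt0.
  have d4 : d <= 4^-1 by rewrite ge_min lexx.
  have Cd : C * d <= e.
    have : d <= e / (C + 1) by rewrite ge_min lexx orbT.
    rewrite ler_pdivlMr// => h; apply: le_trans h.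
    by rewrite mulrC ler_wpM2l ?ltW// ltrDl.
  have h := competitor_energy i beta t1 u1 tu d0 d4 eta01.
  apply: (@le_trans _ _ (`|beta|%:~R * psi eta (delta_mx 0 i) t + C * d)%:E).
    apply: le_trans h; apply: ereal_inf_lbound.
    exists (competitor t u d beta), (competitor_theta t u d i beta),
      (competitor_tau t u d beta).
    split; [exact: competitor_Mdf|exact: competitor_near_boundary|reflexivity].
  by rewrite EFinD leeD2l// lee_fin.
apply: le_ereal_inf_tmp => _ [gamma [theta [tau [mdf near ->]]]].
exact: (energy_ge eta01 t1 mdf near).
Qed.
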